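(* Let $G$ be a plane graph with a weight function on its edges, and let an arbitrary weight function be given on the edges of its planar dual $G^*$. Weight each edge of the dual refinement $H_G$ as follows: an edge joining an original vertex to the edge-vertex of an edge $e$ of $G$ gets the weight of $e$; an edge joining the edge-vertex of $e$ to a face-vertex gets the weight of the edge of $G^*$ dual to $e$ if $e$ separates two bounded faces, and weight $1$ if $e$ lies on the boundary of the unbounded face. Let $v_1,\dots,v_{2n+1}$ and $v'_1,\dots,v'_{2n+1}$ be vertices of $G$ on the boundary of the unbounded face such that: (i) $v_1v_2\cdots v_{2n+1}$ is a path in $G$; (ii) $v'_1v'_2\cdots v'_{2n+1}$ is a path in $G$; (iii) $v_1,\dots,v_{2n+1},v'_{2n+1},v'_{2n},\dots,v'_1$ appear in this (counterclockwise) cyclic order on that boundary; (iv) $v_2,v_4,\dots,v_{2n},v'_2,v'_4,\dots,v'_{2n}$ have degree $2$ in $G$ and belong to distinct bounded faces of $G$. Let $\widehat{H}_G$ be obtained from $H_G$ by smashing in each of $v_2,v_4,\dots,v_{2n},v'_2,\dots,v'_{2n}$, and let $f_{2i}$ (resp. $f'_{2i}$) be the face-vertex obtained by smashing in $v_{2i}$ (resp. $v'_{2i}$). (a) There is a weight-preserving bijection between the perfect matchings of $\widehat{H}_G\setminus\{v_1,f_2,v_3,f_4,\dots,f_{2n},v_{2n+1}\}$ and the perfect matchings of $\widehat{H}_G\setminus\{v'_1,f'_2,v'_3,f'_4,\dots,f'_{2n},v'_{2n+1}\}$. (b) More generally, let $P_1,\dots,P_{2n+1}$ be pairwise vertex-disjoint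 paths in $H_G$ such that, for $i=1,\dots,n+1$, $P_{2i-1}$ is (the subdivision in $H_G$ of) a path in $G$ from $v_{2i-1}$ to $v'_{2i-1}$, and for $i=1,\dots,n$, $P_{2i}$ is (the subdivision in $H_G$ of) a path in $G^*$ from $f_{2i}$ to $f'_{2i}$; regard $P_1,P_2,\dots,P_{2n+1}$ as starting at $v_1,f_2,v_3,\dots,f_{2n},v_{2n+1}$ respectively, and write $\operatorname{s}_P,\operatorname{e}_P$ for the starting and ending vertices of a path $P$. Then for every $I\subseteq[2n+1]$ there is a weight-preserving bijection between (1) the set of perfect matchings of $\widehat{H}_G\setminus\{v_1,f_2,v_3,\dots,f_{2n},v_{2n+1}\}$ that contain all edges of the unique perfect matching of the path $P_i\setminus\operatorname{s}_{P_i}$ for every $i\in I$, and (2) the set of perfect matchings of $\widehat{H}_G\setminus\{v'_1,f'_2,v'_3,\dots,f'_{2n},v'_{2n+1}\}$ that contain all edges of the unique perfect matching of the path $P_i\setminus\operatorname{e}_{P_i}$ for every $i\in I$.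
   Context: Graphs have no loops or multiple edges; $G$ has no vertex of degree one inside a bounded face. The planar dual $G^*$ has a vertex for each bounded face of $G$, two being adjacent when the faces share an edge (the edge of $G^*$ crossing an edge $e$ of $G$ is its dual). The dual refinement $H_G$ has as vertices the vertices of $G$ (original vertices), one face-vertex per bounded face of $G$, and one edge-vertex at the midpoint of each edge of $G$; the edge-vertex of an edge $e$ is joined to the two endpoints of $e$ and to the face-vertex of each bounded face whose boundary contains $e$. A path in $G$ (resp. $G^*$) is regarded as a path in $H_G$ by inserting the edge-vertex of each edge of $G$ traversed (resp. crossed). If $v$ is an original vertex of degree 2 on the boundary of the unbounded face, ''smashing in $v$'' means removing from the graph $v$ together with the two edge-vertices adjacent to $v$ (these lie on the unbounded face); the face-vertex of the bounded face containing $v$ is said to be obtained by smashing in $v$. Removing a vertex removes its incident edges. The weight of a perfect matching is the product of the weights of its edges; a bijection is weight-preserving if corresponding matchings have equal weights. *)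

(* Defs.v *)
From HB Require Import structures.
From mathcomp Require Import all_boot all_algebra.

Set Implicit Arguments.
Unset Strict Implicit.
Unset Printing Implicit Defensive.

(* Each edge e carries two opposite darts (e, true) and (e, false). *)
Definition opp (E : Type) (d : E * bool) : E * bool := (d.1, ~~ d.2).

(* The combinatorial data of a drawing in the plane, possibly disconnected.
   - [rot d] is the next dart counterclockwise around the origin [src d].
   - [face d] is the face on the right of [d]; [Some f] is a bounded face and
     [None] is the unbounded one. With this choice bounded faces are traced
     clockwise and the unbounded face is traced counterclockwise.
   - [isoface x] is the face containing x; it is only used for isolated x. *)
Record plane_map := PlaneMap {
  vert : finType;
  edge : finType;
  bface : finType;
  src : edge * bool -> vert;
  rot : edge * bool -> edge * bool;
  face : edge * bool -> option bface;
  isoface : vert -> option bface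
}.

Section PlaneMap.
Variable G : plane_map.
Local Notation dart := (edge G * bool)%type.

(* the dart following d on the boundary walk of the face on the right of d *)
Definition face_step (d : dart) : dart := rot (opp d).

Definition joins (e : edge G) (x y : vert G) : bool :=
  [exists b, (src (e, b) == x) && (src (e, ~~ b) == y)].

Definition adj (x y : vert G) : bool := [exists e, joins e x y].

Definition degree (x : vert G) : nat := #|[set d : dart | src d == x]|.

(* x lies on the boundary of F *)
Definition lies_on (x : vert G) (F : option (bface G)) : bool :=
  [exists d, (src d == x) && (face d == F)]
  || (degree x == 0) && (isoface x == F).

Definition boundary_rel (a b : vert G + option (bface G)) : bool :=
  match a, b with
  | inl x, inr F | inr F, inl x => lies_on x F
  | _, _ => false
  end.

Definition nb_boundary_walks : nat :=
  fcard face_step predT + #|[set x | degree x == 0]|.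

Definition nb_components : nat := n_comp adj predT.

End PlaneMap.

(* The boundary of a face consists of closed walks (orbits of face_step) and
   isolated vertices, collectively called boundary walks. The drawing is plane
   iff each connected component is (Euler's formula V + B = E + 2c, where B is
   the number of boundary walks and c the number of components), and the graph
   on components and faces with one link per boundary walk is a tree (it is
   connected and B + 1 = c + F). *)
Record plane_graph := PlaneGraph {
  pmap :> plane_map;
  no_loop : forall e : edge pmap, src (e, true) != src (e, false);
  no_multi : injective (fun e : edge pmap => [set src (e, true); src (e, false)]);
  src_rot : forall d : edge pmap * bool, src (rot d) = src d;
  rot_cyclic : forall d d' : edge pmap * bool,
    src d = src d' -> fconnect (@rot pmap) d d';
  face_stepE : forall d : edge pmap * bool, face (face_step d) = face d;
  euler_genus0 :
    #|vert pmap| + nb_boundary_walks pmap = #|edge pmap| + 2 * nb_components pmap;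
  faces_connected : forall a b, connect (@boundary_rel pmap) a b;
  faces_tree :
    (nb_boundary_walks pmap).+1 = nb_components pmap + #|{: option (bface pmap)}|
}.

(* Vertices of the dual refinement H_G. *)
Notation hvert G := (vert G + bface G + edge G)%type.

(* Edges of H_G: every edge has exactly one end that is an edge-vertex, and
   (e, z) stands for the edge between the edge-vertex of e and z. *)
Notation hpair G := (edge G * (vert G + bface G))%type.

Section PlaneGraphTheory.
Variable G : plane_graph.
Local Notation dart := (edge G * bool)%type.

Definition no_inner_leaf : Prop :=
  forall d : dart, degree (src d) = 1 -> face d = None.

Definition is_path (s : seq (vert G)) : bool :=
  sorted (@adj G) s && uniq s.

(* The vertices of s sit at distinct corners of the unbounded face which are
   met in this order along one counterclockwise boundary walk (at a cut
   vertex the walk passes several times, hence the darts). *)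
Definition ccw_on_outer_boundary (s : seq (vert G)) : Prop :=
  exists (d : dart) (c : seq dart),
    [/\ face d = None, subseq c (orbit (@face_step G) d) & [seq src x | x <- c] = s].

(* e lies on the boundary of F *)
Definition borders (e : edge G) (F : option (bface G)) : bool :=
  [exists b, face (e, b) == F].

(* The edge of G^* dual to e joins f and g; dual edges are indexed by the
   edges of G, since two faces may share several edges. *)
Definition dual_joins (e : edge G) (f g : bface G) : bool :=
  [exists b, (face (e, b) == Some f) && (face (e, ~~ b) == Some g)].

Definition OV (x : vert G) : hvert G := inl (inl x).
Definition FV (f : bface G) : hvert G := inl (inr f).
Definition EV (e : edge G) : hvert G := inr e.

Definition hedges : {set hpair G} :=
  [set p : hpair G | match p.2 with
                   | inl x => [exists b, src (p.1, b) == x]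
                   | inr f => borders p.1 (Some f)
                   end].

Definition hends (p : hpair G) : {set hvert G} := [set EV p.1; inl p.2].

(* M is a perfect matching of the graph with vertex set A and edge set the
   members of Es having both ends in A *)
Definition perfect_matching (Es : {set hpair G}) (A : {set hvert G})
    (M : {set hpair G}) : bool :=
  (M \subset [set p in Es | hends p \subset A]) &&
  [forall a in A, #|[set p in M | a \in hends p]| == 1].

(* If e is a bridge with the same bounded face f on both sides, its dual edge
   is a loop at f, and the edge (e, f) of H_G gets the weight of that loop. *)
Definition hweight (R : comPzSemiRingType) (w wd : edge G -> R) (p : hpair G) : R :=
  match p.2 with
  | inl _ => w p.1
  | inr _ => if borders p.1 None then 1%R else wd p.1
  end.

Definition mweight (R : comPzSemiRingType) (w wd : edge G -> R)
    (M : {set hpair G}) : R :=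
  (\prod_(p in M) hweight w wd p)%R.

Definition weight_preserving_bijection (R : comPzSemiRingType)
    (w wd : edge G -> R) (X Y : {set {set hpair G}}) : Prop :=
  exists phi : {set hpair G} -> {set hpair G},
    [/\ {in X &, injective phi}, phi @: X = Y
      & {in X, forall M, mweight w wd (phi M) = mweight w wd M}].

(* Vertex set of H_G after smashing in all members of S; all graphs obtained
   from H_G by deleting vertices are induced subgraphs. *)
Definition smash (S : {set vert G}) : {set hvert G} :=
  ~: ([set OV x | x in S] :|:
      [set EV e | e : edge G & [exists x in S, (e, inl x) \in hedges]]).

(* Paths in G (link := joins, c := OV) and in G^* (link := dual_joins,
   c := FV): a path is given by its first vertex and the sequence of pairs
   (edge traversed, next vertex). *)
Fixpoint walk (T : Type) (link : edge G -> rel T) (x : T)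
    (s : seq (edge G * T)) : bool :=
  if s is (e, y) :: s' then link e x y && walk link y s' else true.

Definition path_from_to (T : eqType) (link : edge G -> rel T) (x : T)
    (s : seq (edge G * T)) (y : T) : bool :=
  [&& walk link x s, uniq (x :: unzip2 s) & last x (unzip2 s) == y].

Definition subdivision (T : Type) (c : T -> hvert G) (x : T)
    (s : seq (edge G * T)) : seq (hvert G) :=
  c x :: flatten [seq [:: EV p.1; c p.2] | p <- s].

Definition is_primal_path (P : seq (hvert G)) (x y : vert G) : Prop :=
  exists2 s, path_from_to (@joins G) x s y & P = subdivision OV x s.

Definition is_dual_path (P : seq (hvert G)) (f g : bface G) : Prop :=
  exists2 s, path_from_to dual_joins f s g & P = subdivision FV f s.

(* The edges of the path in H_G with vertex sequence P. *)
Definition path_edges (P : seq (hvert G)) : {set hpair G} :=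
  [set p in hedges | infix [:: EV p.1; inl p.2] P || infix [:: inl p.2; EV p.1] P].

(* M contains all edges of the (unique) perfect matching of the path P. *)
Definition contains_path_matching (P : seq (hvert G)) (M : {set hpair G}) : bool :=
  [exists N, perfect_matching (path_edges P) [set a in P] N && (N \subset M)].

Definition del_start (P : seq (hvert G)) : seq (hvert G) := behead P.
Definition del_end (P : seq (hvert G)) : seq (hvert G) := rev (behead (rev P)).

End PlaneGraphTheory.

(* The indices 1, ..., 2n+1 are represented by 0, ..., 2n:
   odd_ix i is the index 2i-1 (i = 1..n+1) and even_ix i is 2i (i = 1..n). *)
Definition odd_ix (n : nat) (i : 'I_n.+1) : 'I_n.*2.+1 := inord i.*2.
Definition even_ix (n : nat) (i : 'I_n) : 'I_n.*2.+1 := inord i.*2.+1.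

(* {v_1, f_2, v_3, ..., f_2n, v_2n+1} *)
Definition terminals (G : plane_graph) (n : nat)
    (v : 'I_n.*2.+1 -> vert G) (f : 'I_n -> bface G) : {set hvert G} :=
  [set OV (v (odd_ix i)) | i : 'I_n.+1] :|: [set FV (f i) | i : 'I_n].

(* Main.v *)
Require Import Defs.
From mathcomp Require Import all_boot all_algebra zify.

(** A perfect matching [M] splits the remaining edges of [G] into the set [A] of those matched to
    vertices and the set [B] of those matched to faces, and orients [(V, A)] and [(F, B)] towards
    the removed vertices and faces (the unbounded face counting as removed). Only [A] matters: the
    weight of [M] and the events in (b) depend on [A] alone, [M] is determined by [A], and the
    sets [A] are the same on both sides.

    For a plane graph, the number of dual components of [E \ X] is controlled by [|X|] and the
    number of components of [X], and conversely (a dual cut is a cycle). First, no set of bounded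
    faces can be enclosed by [A], since it would have more vertices and faces than edges in its
    interior; so every vertex is joined by [A] to a removed vertex, and every face by [B] to a
    removed face. Adding to [A] the edges at the even vertices of one of the two paths, and
    comparing component counts on both sides of the duality, gives the same with the roots [v_i],
    [f_i] replaced by [v'_i], [f'_i]. A graph all of whose vertices are joined to a set of roots,
    with as many edges as non-roots, has exactly one orientation towards these roots; reorienting
    [A] and [B] towards the primed roots is the bijection. *)

Set Implicit Arguments.
Unset Strict Implicit.
Unset Printing Implicit Defensive.

(* [all_algebra] shadows these names. *)
Local Notation opp := Defs.opp.
Local Notation root := fingraph.root.
Local Notation rot := Defs.rot.

(** * Connected components of a finite multigraph given by its darts *)

Section Components.
Variables (E T : finType) (p : E * bool -> T).
Implicit Types (X Y : {set E}) (S : {set T}) (x y : T).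

(** [p] sends a dart to its origin. Taking [src] or [face] for [p] gives the graph or its dual
    (unbounded face included) on one common edge type. *)
Definition link X : rel T :=
  [rel x y | [exists e in X, exists b, (p (e, b) == x) && (p (e, ~~ b) == y)]].

Definition comps X : nat := n_comp (link X) predT.

Lemma link_dart X d : d.1 \in X -> link X (p d) (p (opp d)).
Proof.
by case: d => e b eX; apply/existsP; exists e; rewrite eX /=; apply/existsP; exists b; rewrite !eqxx.
Qed.

Lemma linkP X x y :
  reflect (exists2 d, d.1 \in X & p d = x /\ p (opp d) = y) (link X x y).
Proof.
apply: (iffP existsP) => [[e /andP[eX /existsP[b /andP[/eqP <- /eqP <-]]]]|].
  by exists (e, b).
by case=> -[e b] /= eX [<- <-]; exists e; rewrite eX; apply/existsP; exists b; rewrite !eqxx.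
Qed.

Lemma oppK (F : Type) : involutive (@opp F).
Proof. by case=> e b; rewrite /opp /= negbK. Qed.

Lemma link_sym X : connect_sym (link X).
Proof.
apply: sym_connect_sym => x y; apply/linkP/linkP => -[d dX [<- <-]];
  by exists (opp d); rewrite ?oppK.
Qed.

Lemma connect_mono X Y x y :
  X \subset Y -> connect (link X) x y -> connect (link Y) x y.
Proof.
move=> sXY; apply: connect_sub => {}x {}y /linkP[d dX [<- <-]].
exact/connect1/link_dart/(subsetP sXY).
Qed.

Lemma link_closed X S x y :
  (forall d, d.1 \in X -> p d \in S -> p (opp d) \in S) ->
  connect (link X) x y -> x \in S -> y \in S.
Proof.
move=> clS /connectP[s]; elim: s x => [|z s IH] x /= => [_ -> //|].
case/andP=> /linkP[d dX [<- <-]] sP yE dS; exact: IH sP yE (clS _ dX dS).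
Qed.

Lemma comps_le X S :
  (forall x, exists2 s, s \in S & connect (link X) x s) -> comps X <= #|S|.
Proof.
move=> reach; apply: (leq_trans _ (leq_imset_card (root (link X)) S)).
apply/subset_leq_card/subsetP => x; rewrite !inE andbT => /eqP rx.
have [s sS xs] := reach x; apply/imsetP; exists s => //.
by rewrite -rx; apply/eqP; rewrite root_connect //; exact: link_sym.
Qed.

Lemma comps_ge X S :
  {in S &, forall x y, connect (link X) x y -> x = y} -> #|S| <= comps X.
Proof.
move=> sep; rewrite -(card_in_imset (f := root (link X)) (D := mem S)).
  by apply/subset_leq_card/subsetP => _ /imsetP[x _ ->]; rewrite !inE andbT roots_root //; exact: link_sym.
move=> x y xS yS /eqP; rewrite root_connect; last exact: link_sym.
exact: sep.
Qed.

Lemma comps_le1 X :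
  (forall x y, connect (link X) x y) -> comps X <= 1.
Proof.
move=> con; have [x0 _|T0] := pickP T.
  by rewrite -(cards1 x0); apply: comps_le => x; exists x0; rewrite ?set11.
rewrite /comps /n_comp_mem eq_card0 // => x.
by have := T0 x.
Qed.

Lemma comps_le1_connect X : comps X <= 1 -> forall x y, connect (link X) x y.
Proof.
move=> c1 x y; apply/negPn/negP => nxy.
suff: #|[set x; y]| <= 1.
  by rewrite cards2; case: eqP nxy => [->|]; rewrite ?connect0.
apply: (leq_trans _ c1); apply: comps_ge => u w; rewrite !inE.
by case/orP=> /eqP-> /orP[]/eqP-> //; rewrite ?(link_sym X y) (negPf nxy).
Qed.

Lemma connect_add e X x y : connect (link (e |: X)) x y ->
  connect (link X) x y \/
  [\/ connect (link X) x (p (e, true)) | connect (link X) x (p (e, false))] /\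
  [\/ connect (link X) y (p (e, true)) | connect (link X) y (p (e, false))].
Proof.
have sym := link_sym X.
case/connectP=> s; elim: s x => [|z s IH] x /= => [_ ->|]; first by left.
case/andP=> /linkP[d dX [dx dz]] sP yE.
have: connect (link X) x z \/ d.1 = e.
  by move: dX; rewrite in_setU1 => /orP[/eqP|dX]; [right|left; rewrite -dx -dz; exact/connect1/link_dart].
case=> [xz|de].
  have [zy|[ze ye]] := IH z sP yE; first by left; exact: connect_trans zy.
  by right; split=> //; case: ze => ze; [left|right]; exact: connect_trans ze.
have xe : [\/ connect (link X) x (p (e, true)) | connect (link X) x (p (e, false))].
  by rewrite -dx -de; case: (d) => e' [] /=; [left|right]; exact: connect0.
have ze : [\/ connect (link X) z (p (e, true)) | connect (link X) z (p (e, false))].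
  by rewrite -dz -de /opp; case: (d) => e' [] /=; [right|left]; exact: connect0.
right; split=> //; have [zy|[_ //]] := IH z sP yE.
by case: ze => ze; [left|right]; rewrite sym; apply: connect_trans zy; rewrite sym.
Qed.

(** Among the class representatives other than that of [p (e, true)], two that become joined would
    both lie in the class of [p (e, false)], hence coincide. *)
Lemma comps_add1 e X : comps X <= (comps (e |: X)).+1.
Proof.
have sym := link_sym X.
pose r := root (link X) (p (e, true)).
pose S := [set x | x \in roots (link X)].
have -> : comps X = #|S| by rewrite cardsE; apply: eq_card => x; rewrite !inE andbT.
rewrite (cardsD1 r) -add1n leq_add ?leq_b1 //; apply: comps_ge => x y.
rewrite !in_setD1 !inE => /andP[xr /eqP rx] /andP[yr /eqP ry] xy.
suff: connect (link X) x y by rewrite -(root_connect sym) rx ry => /eqP.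
have nr z : root (link X) z = z -> z != r -> ~ connect (link X) z (p (e, true)).
  by move=> rz zr ze; case/eqP: zr; rewrite -rz; apply/eqP; rewrite root_connect.
have [//|[[/(nr _ rx xr)//|xe] [/(nr _ ry yr)//|ye]]] := connect_add xy.
by apply: connect_trans xe _; rewrite sym.
Qed.

Lemma comps_add_connected e X :
  connect (link X) (p (e, true)) (p (e, false)) -> comps X <= comps (e |: X).
Proof.
move=> ce; have sym := link_sym X.
rewrite /comps (@eq_n_comp _ (link X) (link (e |: X))) // => x y.
apply/idP/idP; first exact/connect_mono/subsetU1.
apply: connect_sub => {}x {}y /linkP[d dX [<- <-]].
move: dX; rewrite in_setU1 => /orP[/eqP de|dX]; last exact/connect1/link_dart.
by move: de; case: d => e' [] /= ->; rewrite /opp //= sym.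
Qed.

Lemma comps0 : #|T| <= comps set0.
Proof.
rewrite -cardsT; apply: comps_ge => x y _ _ xy.
apply/esym/set1P; apply: link_closed xy (set11 x).
by move=> d; rewrite in_set0.
Qed.

(** The vertices outside [S] are isolated, and any one vertex of [S] gives a further component. *)
Lemma comps_isolated X S :
  (forall d, d.1 \in X -> p d \in S) -> S != set0 ->
  #|T| < comps X + #|S|.
Proof.
move=> XS /set0Pn[s sS].
have: #|s |: ~: S| <= comps X.
  apply: comps_ge => x y.
  have iso u w : u \notin S -> connect (link X) u w -> w = u.
    move=> uS uw; apply/set1P; apply: link_closed uw (set11 u) => d /XS dS.
    by rewrite in_set1 => /eqP du; rewrite du (negPf uS) in dS.
  rewrite !inE => /orP[/eqP->|xS] /orP[/eqP->|yS] // con.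
  - by apply: (iso y s) => //; rewrite link_sym.
  - by apply/esym; apply: iso.
  - by apply/esym; apply: iso.
rewrite cardsU1 inE sS /= => c1; rewrite -(cardsC S); lia.
Qed.

End Components.

(* [q] plays the dual of [p]: turning around [x] one leaves each region [D] as often as one enters
   it. *)
Definition balanced (E T U : finType) (p : E * bool -> T) (q : E * bool -> U) :=
  forall x (D : {set U}),
    \sum_(d | p d == x) (q d \in D) = \sum_(d | p d == x) (q (opp d) \in D).

(** * The rank inequality between a graph and its dual *)

Section Duality.
Variables (E T U : finType) (p : E * bool -> T) (q : E * bool -> U).
Hypothesis pq : balanced p q.

Lemma balanced_sets (S : {set T}) (D : {set U}) :
  \sum_e \sum_b (p (e, b) \in S) * (q (e, b) \in D) =
  \sum_e \sum_b (p (e, b) \in S) * (q (e, ~~ b) \in D).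
Proof.
rewrite !pair_big /=.
transitivity (\sum_(x in S) \sum_(d | p d == x) (q d \in D)).
  rewrite (partition_big p predT) //= [RHS]big_mkcond /=; apply: eq_bigr => x _.
  case: ifPn => xS; first by apply: eq_bigr => -[e b] /= /eqP->; rewrite xS mul1n.
  by rewrite big1 // => -[e b] /= /eqP->; rewrite (negPf xS).
under eq_bigr => x _ do rewrite pq.
rewrite [RHS](partition_big p predT) //= big_mkcond /=; apply: eq_bigr => x _.
case: ifPn => xS; first by apply: eq_bigr => -[e b] /= /eqP->; rewrite xS mul1n.
by rewrite big1 // => -[e b] /= /eqP->; rewrite (negPf xS).
Qed.

(* The boundary of the region [D] cut off by [e] is even at each vertex and lies in [e |: X], so
   [X] must join the ends of [e]. *)
Lemma dual_bridge_cycle e (X Y : {set E}) : e \notin X ->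
  (forall e', e' \notin X -> e' != e -> e' \in Y) ->
  ~~ connect (link q Y) (q (e, true)) (q (e, false)) ->
  connect (link p X) (p (e, true)) (p (e, false)).
Proof.
move=> eX XY nq; apply/negPn/negP => np.
pose S := [set x | connect (link p X) (p (e, true)) x].
pose D := [set u | connect (link q Y) (q (e, true)) u].
(* [e] contributes 1 to the left sum and 0 to the right one. Any other edge contributes equally to
   both: an edge of [X] has both ends or neither in [S], an edge of [Y] both sides or neither in
   [D]. *)
have := balanced_sets S D.
rewrite (bigD1 e) //= [RHS](bigD1 e) //= !big_bool /=.
rewrite !inE !connect0 (negPf np) (negPf nq) /=.
suff -> : \sum_(i | i != e) \sum_b (p (i, b) \in S) * (q (i, b) \in D) =
  \sum_(i | i != e) \sum_b (p (i, b) \in S) * (q (i, ~~ b) \in D).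
  by move/addIn.
apply: eq_bigr => i ie; rewrite !big_bool /=.
have [iX|/XY/(_ ie) iY] := boolP (i \in X).
  have -> : (p (i, true) \in S) = (p (i, false) \in S).
    rewrite !inE; apply: same_connect_r; first exact: link_sym.
    exact/connect1/(@link_dart _ _ _ _ (i, true)).
  by rewrite addnC.
suff -> : (q (i, true) \in D) = (q (i, false) \in D) by [].
rewrite !inE; apply: same_connect_r; first exact: link_sym.
exact/connect1/(@link_dart _ _ _ _ (i, true)).
Qed.

(** [X] grows by one edge [e] at a time. If deleting [e] from the dual does not separate its sides,
    the left side does not grow, and [#|X|] makes up for a component lost in [comps p X]. Otherwise
    [e] closes a cycle in [X], so [comps p X] does not drop and [#|X|] pays for the new dual
    component. *)
Lemma comps_dual (X : {set E}) : comps q setT <= 1 ->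
  #|T| + comps q (~: X) <= #|X| + comps p X + 1.
Proof.
move=> c1; have [n] := ubnP #|X|; elim: n X => // n IH X Xn.
have [->|/set0Pn[e eX]] := eqVneq X set0.
  by rewrite cards0 setC0; have := comps0 p; lia.
pose X1 := X :\ e; have e1 : e \notin X1 by rewrite !inE eqxx.
have cX : #|X| = #|X1|.+1 by rewrite (cardsD1 e X) eX.
have XE : X = e |: X1 by rewrite setD1K.
have YE : ~: X1 = e |: ~: X by apply/setP=> i; rewrite !inE; case: eqVneq.
have := IH X1; rewrite -ltnS -cX => /(_ Xn); rewrite YE.
have [cq|ncq] := boolP (connect (link q (~: X)) (q (e, true)) (q (e, false))).
  have := comps_add_connected cq; have := comps_add1 p e X1; rewrite -XE; lia.
have cp : connect (link p X1) (p (e, true)) (p (e, false)).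
  apply: dual_bridge_cycle ncq => // i; rewrite !inE => + ie; by rewrite ie.
have := comps_add_connected cp; have := comps_add1 q e (~: X); rewrite -XE; lia.
Qed.

End Duality.

(** * Orientations of a graph towards a set of roots *)

Section Orientations.
Variables (E T : finType) (p : E * bool -> T).
Implicit Types (X : {set E}) (Rt : {set T}) (o : T -> E).

(* A graph with edge set [X] oriented towards the roots [Rt]: [o x] is the edge leaving [x]. *)
Definition orients X Rt o : Prop :=
  [/\ {in ~: Rt &, injective o}, o @: (~: Rt) = X &
      forall x, x \notin Rt -> exists b, p (o x, b) = x].

Definition reaches X Rt : Prop :=
  forall x, exists2 s, s \in Rt & connect (link p X) x s.

Lemma orients_card X Rt o : orients X Rt o -> #|X| + #|Rt| = #|T|.
Proof. by case=> oinj <- _; rewrite card_in_imset // addnC cardsC. Qed.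

Lemma orients_in X Rt o x : orients X Rt o -> x \notin Rt -> o x \in X.
Proof. by case=> _ <- _ xR; apply: imset_f; rewrite inE. Qed.

(** [h] is the distance to [Rt]. *)
Lemma reaches_height X Rt : reaches X Rt ->
  exists h : T -> nat, forall x, x \notin Rt -> exists2 y, link p X x y & h y < h x.
Proof.
move=> reach.
pose pr x k := [exists s : k.-tuple T, path (link p X) x s && (last x s \in Rt)].
have ex x : exists k, pr x k.
  have [r rR /connectP[s sP rE]] := reach x; exists (size s).
  by apply/existsP; exists (in_tuple s); rewrite sP -rE rR.
exists (fun x => ex_minn (ex x)) => x xR.
case: (ex_minnP (ex x)) => k /existsP[s /andP[sP sR]] _.
case: s sP sR => -[|y s] /= /eqP <-; first by rewrite (negPf xR).
case/andP=> xy sP sR; exists y => //.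
case: (ex_minnP (ex y)) => m _ minm; rewrite ltnS; apply: minm.
by apply/existsP; exists (in_tuple s); rewrite sP sR.
Qed.

(* The out-edges of any orientation agree with those that decrease the distance to the roots; the
   count makes the latter exhaust [X]. *)
Lemma reaches_orients X Rt (e0 : E) : reaches X Rt -> #|X| + #|Rt| = #|T| ->
  exists2 o, orients X Rt o &
    forall o', orients X Rt o' -> {in ~: Rt, o' =1 o}.
Proof.
move=> reach card; have [h hP] := reaches_height reach.
pose good x d := [&& d.1 \in X, p d == x & h (p (opp d)) < h x].
pose o x := odflt e0 (omap fst [pick d | good x d]).
have oP x : x \notin Rt -> exists b, good x (o x, b).
  move=> /hP[y /linkP[d dX [dx dy]] hy]; rewrite /o.
  case: pickP => [[e b] gd|/(_ d)]; first by exists b.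
  by rewrite /good dX dx dy hy eqxx.
have oX x : x \notin Rt -> o x \in X by move=> /oP[b /andP[]].
have oinj : {in ~: Rt &, injective o}.
  move=> x y; rewrite !inE => /oP[b /and3P[_ /eqP xb hx]] /oP[c /and3P[_ /eqP yc hy]] oxy.
  move: xb hx; rewrite oxy; move: yc hy.
  have [->|bc] := eqVneq b c; first by move=> ->.
  have -> : c = ~~ b by case: b c bc => -[].
  by rewrite /opp /= negbK => -> /[swap] -> /ltn_trans lt /lt; rewrite ltnn.
have oimg : o @: (~: Rt) = X.
  apply/eqP; rewrite eqEcard card_in_imset //; apply/andP; split.
    by apply/subsetP=> _ /imsetP[x xR ->]; apply: oX; rewrite inE in xR.
  by have := cardsC Rt; lia.
exists o; first by split=> // x /oP[b /and3P[_ /eqP]]; exists b.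
move=> o' [o'inj o'img o'inc].
(* Induction on the height. The edge [o x] lies in [X], so it is [o' z] for one of its ends [z]. If
   [z] were the end other than [x], it would be lower, so [o z = o' z = o x] and [z = x] by
   injectivity, which is absurd. *)
suff ind n x : h x < n -> x \notin Rt -> o' x = o x.
  by move=> x; rewrite inE; apply: (ind (h x).+1).
elim: n x => // n IH x hn xR; have [b /and3P[eX /eqP xb hx]] := oP _ xR.
move: (eX); rewrite -o'img => /imsetP[z zR oz].
have zR' : z \notin Rt by rewrite inE in zR.
rewrite /opp /= in oz hx; have [c zc] := o'inc z zR'.
case: (eqVneq b c) => [bc|nbc]; first by rewrite [RHS]oz -[in RHS]zc -bc -oz xb.
have zE : z = p (o x, ~~ b) by rewrite -zc -oz; suff -> : ~~ b = c by []; move: nbc; case: (b) (c) => -[].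
have oxz : o x = o z by rewrite oz; apply: IH => //; rewrite zE; apply: leq_trans hx _.
by move: hx; rewrite -zE (oinj x z) ?inE // ltnn.
Qed.

End Orientations.

(** * Reachability of the roots from Euler's relation *)

Section PlaneDuality.
Variables (E T U : finType) (p : E * bool -> T) (q : E * bool -> U).
Hypotheses (qp : balanced q p) (pcon : comps p setT <= 1).
Hypothesis euler : #|E| + 2 = #|T| + #|U|.

(* Vertices that miss the roots would carry a cycle, and a cycle separates its complement in the
   dual. *)
Lemma orients_reaches X Rt o :
  orients p X Rt o -> comps q (~: X) <= 1 -> reaches p X Rt.
Proof.
move=> oP qcon x0.
pose S := [set x | [forall s in Rt, ~~ connect (link p X) x s]].
have SP x : x \notin S -> exists2 s, s \in Rt & connect (link p X) x s.
  rewrite inE negb_forall => /existsP[s]; rewrite negb_imply negbK => /andP[]; by exists s.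
have [S0|S0] := eqVneq S set0; first by apply: SP; rewrite S0 inE.
have SR : S \subset ~: Rt.
  apply/subsetP=> x; rewrite !inE => /forall_inP xS; apply/negP => /xS.
  by rewrite connect0.
pose Y := o @: S.
have [oinj _ oinc] := oP.
have cY : #|Y| = #|S|.
  by rewrite card_in_imset // => x y /(subsetP SR) xR /(subsetP SR); apply: oinj.
have YX : Y \subset X.
  apply/subsetP=> _ /imsetP[x /(subsetP SR) xS ->]; apply: (orients_in oP).
  by rewrite inE in xS.
have iso d : d.1 \in Y -> p d \in S.
  case/imsetP=> x xS dx; have xR : x \notin Rt by have:= subsetP SR _ xS; rewrite inE.
  have [b xb] := oinc x xR.
  have con : connect (link p X) (p d) x.
    have dX : d.1 \in X by rewrite dx (orients_in oP).
    case: d dx dX => e c /= -> dX; rewrite -{2}xb.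
    case: (eqVneq b c) => [->|]; first exact: connect0.
    case: b c {xb} => -[] // _; exact/connect1/(@link_dart _ _ _ _ (o x, _)).
  move: xS; rewrite !inE => /forall_inP xS; apply/forall_inP=> s /xS.
  by apply: contra => ds; rewrite (connect_trans _ ds) // link_sym.
have qY : comps q (~: Y) <= 1.
  apply: comps_le1 => u w; apply: connect_mono (comps_le1_connect qcon u w).
  by rewrite setCS.
(* [Y] touches only [S], so it has at least [#|T| - #|S| + 1] components; as [#|Y| = #|S|], this is
   one more than duality and [euler] allow. *)
have := comps_dual qp (~: Y) pcon; rewrite setCK.
have := comps_isolated iso S0; have := cardsC Y; lia.
Qed.

End PlaneDuality.

(** * Plane drawings: rotation, connectedness of the dual, enclosed faces *)

Section PlaneFacts.
Variable G : plane_graph.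
Local Notation dart := (edge G * bool)%type.
Implicit Types (d : dart) (x : vert G) (X : {set edge G}).

(** By [rot_cyclic], [d] lies in the [rot]-orbit of [rot d] and so is an image; a surjection of a
    finite type to itself is injective. *)
Lemma rot_inj : injective (@rot G).
Proof.
suff surj d : exists d', rot d' = d.
  have /imset_injP inj : #|[set rot d | d in [set: dart]]| == #|[set: dart]|.
    apply/eqP; congr #|pred_of_set _|; apply/setP=> d; rewrite inE.
    by have [d' <-] := surj d; rewrite imset_f.
  by move=> d d'; apply: inj; rewrite inE.
have /rot_cyclic/iter_findex <- : src (rot d) = src d by exact: src_rot.
by rewrite -iterSr; eexists; rewrite iterS.
Qed.

Lemma face_step_inj : injective (@face_step G).
Proof. by move=> d d' /rot_inj /(inv_inj (@oppK _)). Qed.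

Lemma face_rot d : face (rot d) = face (opp d).
Proof. by rewrite -(face_stepE (opp d)) /face_step oppK. Qed.

Lemma src_step d : src (face_step d) = src (opp d).
Proof. exact: src_rot. Qed.

Lemma balanced_src_face : balanced (@src G) (@face G).
Proof.
move=> x D; rewrite (reindex_inj rot_inj) /=.
by apply: eq_big => d; rewrite ?src_rot // face_rot.
Qed.

Lemma balanced_face_src : balanced (@face G) (@src G).
Proof.
move=> F S; rewrite (reindex_inj face_step_inj) /=.
by apply: eq_big => d; rewrite ?face_stepE // src_step.
Qed.

Lemma comps_src : comps (@src G) setT = nb_components G.
Proof.
apply: eq_n_comp => x y; apply: eq_connect => {}x {}y.
by apply: eq_existsb => e; rewrite inE.
Qed.

(** Turning around [x] crosses one edge at a time; an isolated vertex lies on a single face. *)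
Lemma lies_on_connect x F F' : lies_on x F -> lies_on x F' ->
  connect (link (@face G) setT) F F'.
Proof.
have deg d : src d = x -> degree x != 0.
  by move=> dx; rewrite -lt0n; apply/card_gt0P; exists d; rewrite inE dx.
case/orP=> [/existsP[d /andP[/eqP dx /eqP <-]]|/andP[/eqP x0 /eqP <-]];
  case/orP=> [/existsP[d' /andP[/eqP dx' /eqP <-]]|/andP[/eqP x0' /eqP <-]] //.
- have: fconnect (@rot G) d d' by apply: rot_cyclic; rewrite dx.
  move/iter_findex <-; elim: (findex _ _ _) => [|k IH]; first exact: connect0.
  rewrite iterS face_rot; apply: connect_trans IH (connect1 _).
  by apply: link_dart; rewrite inE.
- by have := deg d dx; rewrite x0'.
- by have := deg d' dx'; rewrite x0.
Qed.

(** A chain of alternating faces and vertices becomes a dual walk by turning around each of its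
    vertices. The invariant [Z] holds at a vertex once some face there is reached. *)
Lemma comps_face : comps (@face G) setT <= 1.
Proof.
apply: comps_le1 => F F'.
pose Z a := match a with
  | inr F1 => connect (link (@face G) setT) F F1
  | inl x => [exists F1, lies_on x F1 && connect (link (@face G) setT) F F1] end.
suff Zcl a b : connect (@boundary_rel G) a b -> Z a -> Z b.
  by apply: (Zcl _ _ (faces_connected (inr F) (inr F'))); exact: connect0.
case/connectP=> s; elim: s a => [|c s IH] a /= => [_ -> //|].
case/andP=> ac sP bE Za; apply: IH sP bE _ => {b s}.
case: a c ac Za => [x|F1] [y|F2] //= xF.
  by case/existsP=> F1 /andP[xF1 FF1]; apply: connect_trans FF1 (lies_on_connect xF1 xF).
by move=> FF1; apply/existsP; exists F1; rewrite xF.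
Qed.

Hypothesis euler : #|edge G| + 2 = #|vert G| + #|{: option (bface G)}|.

(** Eliminating the boundary walks from [euler_genus0] and [faces_tree] leaves [V + F = E + 1 + c],
    with [c] the number of components. *)
Lemma euler_connected : nb_components G = 1.
Proof. have := euler_genus0 G; have := faces_tree G; lia. Qed.

Lemma comps_src1 : comps (@src G) setT <= 1.
Proof. by rewrite comps_src euler_connected. Qed.

(** A connected drawing with an edge has no isolated vertex, so [faces_tree] counts as many orbits
    of [face_step] as faces. Every face has a dart, so the map from orbits to faces is a
    bijection. *)
Lemma same_face d d' : face d = face d' -> fconnect (@face_step G) d d'.
Proof.
have sym := fconnect_sym face_step_inj.
have noiso x : degree x != 0.
  apply/negP=> /eqP x0.
  have nox d1 : src d1 <> x.
    by move=> dx; move: (card0_eq x0 d1); rewrite !inE dx eqxx.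
  apply: (nox d); apply/set1P.
  apply: (link_closed _ (comps_le1_connect comps_src1 x (src d)) (set11 x)).
  by move=> d1 _ /set1P /nox.
have fface a b : fconnect (@face_step G) a b -> face a = face b.
  by move/iter_findex <-; elim: (findex _ _ _) => // k IH; rewrite iterS face_stepE.
pose r := [set a : dart | fingraph.roots (frel (@face_step G)) a].
have rC : #|r| = #|{: option (bface G)}|.
  have := faces_tree G; rewrite euler_connected /nb_boundary_walks.
  rewrite [#|[set x | _]|]eq_card0; last by move=> x; rewrite inE (negPf (noiso x)).
  rewrite addn0 add1n => -[<-]; rewrite /n_comp_mem cardsE.
  by apply: eq_card => a; rewrite !inE andbT.
have imgT : [set face a | a in r] = setT.
  apply/setP=> F; rewrite inE.
  have [a aF] : exists a, face a = F.
    have /connectP[[//|b s] /= /andP[]] := faces_connected (inr F) (inl (src d)).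
    case: b => //= x xF _ _; move: xF; rewrite /lies_on (negPf (noiso x)) orbF.
    by case/existsP=> a /andP[_ /eqP]; exists a.
  apply/imsetP; exists (root (frel (@face_step G)) a); first by rewrite inE roots_root.
  by rewrite -aF; apply/fface/connect_root.
have /imset_injP inj : #|[set face a | a in r]| == #|r|.
  by rewrite imgT rC cardsT.
move=> dd'; rewrite -(root_connect sym); apply/eqP/inj; rewrite ?inE ?roots_root //.
by rewrite -(fface _ _ (connect_root _ d)) -(fface _ _ (connect_root _ d')).
Qed.

Lemma same_face_connect X d d' :
  (forall a, face a = face d -> a.1 \in X) -> face d = face d' ->
  connect (link (@src G) X) (src d) (src d').
Proof.
move=> dX /same_face /iter_findex <-; elim: (findex _ _ _) => [|k IH]; first exact: connect0.
rewrite iterS src_step; apply: connect_trans IH (connect1 _); apply: link_dart; apply: dX.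
by elim: k => // k IH; rewrite iterS face_stepE.
Qed.

(* If [D] is the set of faces cut off from the unbounded one by [X], the boundaries of the other
   faces are connected, so [D] has more vertices and faces than edges in its interior; but [ov]
   and [of_] embed these vertices and faces into these edges. *)
Lemma orients_no_enclosed_face X B Rv Rf ov of_ d0 :
  orients (@src G) X Rv ov -> orients (@face G) B Rf of_ -> B \subset ~: X ->
  face d0 = None ->
  (forall x, x \in Rv -> exists2 d, src d = x & face d = None) ->
  (forall g, g \in Rf -> connect (link (@face G) (~: X)) None g) ->
  comps (@face G) (~: X) <= 1.
Proof.
move=> oV oF BX d0N RvN RfN.
pose D := [set g | ~~ connect (link (@face G) (~: X)) None g].
have Dout d : d.1 \in ~: X -> (face d \in D) = (face (opp d) \in D).
  move=> dX; rewrite !inE; congr negb; apply: same_connect_r; first exact: link_sym.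
  exact/connect1/link_dart.
have [D0|Dn0] := eqVneq D set0.
  have con g : connect (link (@face G) (~: X)) None g.
    by have := in_set0 g; rewrite -D0 inE => /negbFE.
  by apply: comps_le1 => g h; apply: connect_trans (con h); rewrite link_sym.
exfalso.
pose ED := [set e | (face (e, true) \in D) && (face (e, false) \in D)].
pose W := [set x | [forall d, (src d == x) ==> (face d \in D)]].
have WP d : src d \in W -> face d \in D.
  by rewrite inE => /forallP/(_ d); rewrite eqxx.
have EDE d : (d.1 \in ED) = (face d \in D) && (face (opp d) \in D).
  by case: d => e []; rewrite inE //= andbC.
have WR x : x \in W -> x \notin Rv.
  by move=> xW; apply/negP=> /RvN[d dx dN]; have := WP d; rewrite dx dN => /(_ xW); rewrite inE connect0.
have DR g : g \in D -> g \notin Rf.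
  by rewrite inE; apply: contra => /RfN.
(* An edge out of a vertex of [W] has faces of [D] on both sides; one out of a face of [D] avoids
   [X], so it does not lead out of [D]. The former edges lie in [X], so none is counted twice. *)
have cWD : #|W| + #|D| <= #|ED|.
  have [[ovinj _ ovinc] [ofinj _ ofinc]] := (oV, oF).
  rewrite -(card_in_imset (f := ov) (D := mem W)); last first.
    by move=> x y xW yW; apply: ovinj; rewrite inE WR.
  rewrite -(card_in_imset (f := of_) (D := mem D)); last first.
    by move=> g h gD hD; apply: ofinj; rewrite inE DR.
  have dis : [disjoint ov @: W & of_ @: D].
    apply/pred0P=> e /=; apply/negP=> /andP[/imsetP[x /WR/(orients_in oV) xX ->]].
    by case/imsetP=> g /DR/(orients_in oF)/(subsetP BX); rewrite inE => /negP gX oE; rewrite -oE in gX.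
  rewrite -leq_card_setU in dis; rewrite -(eqP dis); apply/subset_leq_card/subsetP=> e.
  rewrite in_setU => /orP[] /imsetP.
    case=> x xW ->; have [b xb] := ovinc x (WR x xW).
    rewrite (EDE (ov x, b)) -face_rot !WP //; last by rewrite xb.
    by rewrite src_rot xb.
  case=> g gD ->; have [b gb] := ofinc g (DR g gD).
  by rewrite (EDE (of_ g, b)) -Dout ?gb ?gD // (subsetP BX) // (orients_in oF) // DR.
have cF : #|{: option (bface G)}| < comps (@face G) ED + #|D|.
  by apply: comps_isolated => // d; rewrite EDE => /andP[].
have cV : comps (@src G) (~: ED) <= #|W| + 1.
  have outE d : face d \notin D -> d.1 \in ~: ED.
    by rewrite in_setC EDE => /negPf ->.
  have con d : face d \notin D -> connect (link (@src G) (~: ED)) (src d) (src d0).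
    move=> dD.
    (* Faces outside [D] whose whole boundary is joined to [src d0] off [ED]. The unbounded face is
       one, and crossing an edge outside [X] preserves the property, since the crossed edge is
       itself off [ED]. *)
    pose Z := [set g | (g \notin D) &&
      [forall a, (face a == g) ==> connect (link (@src G) (~: ED)) (src a) (src d0)]].
    suff: face d \in Z by rewrite inE dD => /forallP/(_ d); rewrite eqxx.
    have: connect (link (@face G) (~: X)) None (face d) by move: dD; rewrite inE negbK.
    move=> c; apply: link_closed c _ => [a aX aZ|].
      move: aZ; rewrite inE => /andP[aD /forallP/(_ a)]; rewrite eqxx => aS.
      have aD' : face (opp a) \notin D by rewrite -Dout.
      rewrite inE aD'; apply/forallP=> a'; apply/implyP=> /eqP fa'.
      apply: connect_trans (_ : connect _ (src (opp a)) _); last first.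
        apply: connect_trans aS; rewrite link_sym; exact/connect1/link_dart/outE.
      by apply: same_face_connect => // a'' fa''; apply: outE; rewrite fa'' fa'.
    have ND : None \notin D by rewrite inE negbK connect0.
    rewrite inE ND; apply/forallP=> a; apply/implyP=> /eqP aN.
    apply: same_face_connect; last by rewrite aN.
    by move=> a' fa'; apply: outE; rewrite fa' aN.
  apply: leq_trans (_ : #|src d0 |: W| <= _); last by rewrite cardsU1 addnC leq_add2l leq_b1.
  apply: comps_le => x; have [xW|] := boolP (x \in W).
    by exists x; rewrite ?connect0 // in_setU1 xW orbT.
  rewrite inE negb_forall => /existsP[d]; rewrite negb_imply => /andP[/eqP <- dD].
  by exists (src d0); rewrite ?setU11 ?con.
(* With [euler], the bounds [cF] and [cV] give [#|ED| < #|W| + #|D|], against [cWD]. *)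
have := comps_dual balanced_src_face (~: ED) comps_face; rewrite setCK.
have := cardsC ED; lia.
Qed.

End PlaneFacts.

Lemma card_disjointU (T : finType) (A A' : {set T}) :
  [disjoint A & A'] -> #|A :|: A'| = #|A| + #|A'|.
Proof. by have [_ <-] := leq_card_setU A A' => /eqP. Qed.

(** * Reachability of the roots on either side *)

Section Sides.
Variable G : plane_graph.
Local Notation dart := (edge G * bool)%type.
Local Notation psrc := (@src G).
Local Notation pface := (@face G).

Definition incident (S : {set vert G}) : {set edge G} :=
  [set e | [exists b, src (e, b) \in S]].

Lemma incidentP (S : {set vert G}) (d : dart) : src d \in S -> d.1 \in incident S.
Proof. by case: d => e b dS; rewrite inE; apply/existsP; exists b. Qed.

Lemma incident_connect_out (S : {set vert G}) (X : {set edge G}) x y : [disjoint X & incident S] ->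
  connect (link psrc X) x y -> x \notin S -> y \notin S.
Proof.
move=> dis xy; rewrite -!in_setC; apply: link_closed xy => d dX _.
rewrite in_setC; apply/negP => /incidentP.
by rewrite (disjointFr dis).
Qed.

(* What is used of the path [v_1, ..., v_(2n+1)]: [O] are its odd vertices, [Ev] its even ones,
   [Rf] consists of the unbounded face and the [f_(2i)]. *)
Record side (n : nat) (O Ev : {set vert G}) (Rf : {set option (bface G)}) : Prop := Side {
  card_odd : #|O| = n.+1;
  card_even : #|Ev| = n;
  card_side_faces : #|Rf| = n.+1;
  side_disjoint : [disjoint O & Ev];
  card_incident : #|incident Ev| = n.*2;
  side_outer : forall x, x \in O :|: Ev -> exists2 d, src d = x & face d = None;
  side_connected :
    {in O :|: Ev &, forall x y, connect (link psrc (incident Ev)) x y};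
  side_None : None \in Rf;
  side_faces_connected :
    forall g, g \in Rf -> connect (link pface (incident Ev)) None g;
  incident_src : forall d : dart, d.1 \in incident Ev -> src d \in O :|: Ev;
  incident_face : forall d : dart, d.1 \in incident Ev -> face d \in Rf
}.

Variables (n : nat) (O Ev O' Ev' : {set vert G}) (Rf Rf' : {set option (bface G)}).
Hypotheses (sd : side n O Ev Rf) (sd' : side n O' Ev' Rf').
Hypotheses (EvEv' : [disjoint Ev & Ev']) (OEv' : [disjoint O & Ev']).

(** The vertices missing from the first graph: the odd terminals and the smashed vertices of both
    paths. [Rv'] is its primed counterpart, and [C] holds the edges whose edge-vertices are
    smashed. *)
Let Rv := O :|: Ev :|: Ev'.
Let Rv' := O' :|: Ev' :|: Ev.
Let C := incident Ev :|: incident Ev'.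

Lemma card_roots : #|Rv| = 3 * n + 1.
Proof.
rewrite !card_disjointU ?(side_disjoint sd) //.
  by rewrite (card_odd sd) (card_even sd) (card_even sd'); lia.
by rewrite -setI_eq0 setIUl !disjoint_setI0 // setU0.
Qed.

Hypotheses (O'Ev : [disjoint O' & Ev]).
Hypothesis incEv : [disjoint incident Ev & incident Ev'].

Lemma card_incidentU : #|C| = 4 * n.
Proof.
by rewrite card_disjointU // (card_incident sd) (card_incident sd'); lia.
Qed.

Variables (X B : {set edge G}) (ov : vert G -> edge G) (of_ : option (bface G) -> edge G).
Hypotheses (oX : orients psrc X Rv ov) (oB : orients pface B Rf of_).
Hypotheses (BE : B = ~: (C :|: X)) (XC : [disjoint X & C]).

Let XEv : [disjoint X & incident Ev].
Proof. exact: disjointWr (subsetUl _ _) XC. Qed.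

Let XEv' : [disjoint X & incident Ev'].
Proof. exact: disjointWr (subsetUr _ _) XC. Qed.

(** The orientations give [#|X| = V - 3n - 1] and [#|B| = F - n - 1]; the other [4n] edges form [C].
    Connectedness of [G] follows through [euler_connected]. *)
Lemma orients_euler : #|edge G| + 2 = #|vert G| + #|{: option (bface G)}|.
Proof.
have := orients_card oX; have := orients_card oB.
have := cardsC (C :|: X); rewrite -BE card_roots (card_side_faces sd).
by rewrite card_disjointU 1?disjoint_sym // card_incidentU => /=; lia.
Qed.

Let euler := orients_euler.
Let con := comps_src1 euler.

Let inB e : (e \in B) = [&& e \notin incident Ev, e \notin incident Ev' & e \notin X].
Proof. by rewrite BE in_setC !in_setU !negb_or andbA. Qed.

Let OEv0 : exists x, x \in O.
Proof. by apply/card_gt0P; rewrite (card_odd sd). Qed.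

Let OEv0' : exists x, x \in O'.
Proof. by apply/card_gt0P; rewrite (card_odd sd'). Qed.

Lemma side_comps_face : comps pface (~: X) <= 1.
Proof.
have [x0 x0O] := OEv0.
have [d0 _ d0N] : exists2 d, src d = x0 & face d = None.
  by apply: (side_outer sd); rewrite in_setU x0O.
apply: (orients_no_enclosed_face euler oX oB _ d0N).
- by apply/subsetP=> e; rewrite inB in_setC => /and3P[].
- move=> x; rewrite in_setU => /orP[/(side_outer sd)//|xE].
  by apply: (side_outer sd'); rewrite in_setU xE orbT.
- move=> g /(side_faces_connected sd); apply: connect_mono.
  by rewrite -disjoints_subset disjoint_sym.
Qed.

Lemma side_reaches_src : reaches psrc X Rv.
Proof.
apply: (orients_reaches (@balanced_face_src G) con euler oX).
exact: side_comps_face.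
Qed.

(** All edges at [Ev'] lie in [C], so its vertices are isolated in [X]. *)
Lemma side_reaches_O x : x \notin Ev' ->
  exists2 s, s \in O :|: Ev & connect (link psrc X) x s.
Proof.
move=> xE; have [s] := side_reaches_src x; rewrite in_setU => /orP[sO xs|sE xs].
  by exists s.
by have := incident_connect_out XEv' xs xE; rewrite sE.
Qed.

(** [X] leads to [O :|: Ev], which the edges at [Ev] hold together; a vertex of [Ev'] is first
    carried to [O'] by the edges at [Ev']. *)
Lemma side_comps_src : comps psrc (~: B) <= 1.
Proof.
have [x0 x0O] := OEv0; have [y0 y0O] := OEv0'.
have XB : X \subset ~: B by rewrite BE setCK subsetUr.
have EB : incident Ev \subset ~: B by rewrite BE setCK /C -setUA subsetUl.
have EB' : incident Ev' \subset ~: B.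
  by rewrite BE setCK /C; apply: subset_trans (subsetUl _ _); exact: subsetUr.
have toO x : x \notin Ev' -> connect (link psrc (~: B)) x x0.
  move=> /side_reaches_O[s sO /(connect_mono XB) xs]; apply: connect_trans xs _.
  by apply: connect_mono EB _; apply: (side_connected sd); rewrite // in_setU x0O.
suff to x : connect (link psrc (~: B)) x x0.
  by apply: comps_le1 => x y; apply: connect_trans (to x) _; rewrite link_sym.
have [xE|/toO//] := boolP (x \in Ev'); apply: connect_trans (toO y0 _).
  apply: connect_mono EB' _.
  by apply: (side_connected sd'); rewrite in_setU ?xE ?y0O ?orbT.
by rewrite (disjointFr (side_disjoint sd')).
Qed.

Lemma side_reaches_face : reaches pface B Rf.
Proof.
have euler' : #|edge G| + 2 = #|{: option (bface G)}| + #|vert G| by rewrite euler addnC.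
apply: (orients_reaches (@balanced_src_face G) (@comps_face G) euler' oB).
exact: side_comps_src.
Qed.

(** Adding the edges at [Ev] to [X] merges [O :|: Ev], which leaves at most [n + 1] components, the
    isolated vertices of [Ev'] included. By duality the complement, [B] with the edges at [Ev'],
    connects all faces. Those edges border only faces of [Rf'], so [B] alone joins each face to
    [Rf']. *)
Lemma side_reaches_face' : reaches pface B Rf'.
Proof.
have [x0 x0O] := OEv0.
pose Y := X :|: incident Ev.
have cY : comps psrc Y <= n.+1.
  apply: leq_trans (_ : #|x0 |: Ev'| <= _); last first.
    by rewrite cardsU1 (card_even sd') -add1n leq_add2r leq_b1.
  apply: comps_le => x; have [xE|/side_reaches_O[s sO xs]] := boolP (x \in Ev').
    by exists x; rewrite ?connect0 // in_setU1 xE orbT.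
  exists x0; first exact: setU11.
  apply: connect_trans (connect_mono (subsetUl _ _) xs) _.
  apply: connect_mono (subsetUr _ _) _; apply: (side_connected sd) => //.
  by rewrite in_setU x0O.
have fY : comps pface (~: Y) <= 1.
  have := comps_dual (@balanced_src_face G) Y (@comps_face G).
  have := orients_card oX; rewrite card_roots card_disjointU // (card_incident sd); lia.
move=> g; pose Z := [set g | [exists s in Rf', connect (link pface B) g s]].
suff: g \in Z by rewrite inE => /exists_inP[s sR gs]; exists s.
apply: link_closed (comps_le1_connect fY None g) _ => [d dY|]; last first.
  by rewrite inE; apply/exists_inP; exists None; rewrite ?(side_None sd').
rewrite !inE => /exists_inP[s sR ds]; apply/exists_inP.
have [dE|dE] := boolP (d.1 \in incident Ev').
  by exists (face (opp d)); rewrite // (incident_face sd').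
exists s => //; apply: connect_trans ds; rewrite link_sym; apply/connect1/link_dart.
by rewrite inB dE; move: dY; rewrite in_setC in_setU negb_or andbC.
Qed.

(** The complement of [Y], which is [B] with the edges at [Ev], connects all faces, so by duality
    [Y] has at most [n + 1] components. The [n] isolated vertices of [Ev] use up all but one, so all
    others are joined to [y0]. The edges added to [X] have both ends in [Rv'], so [X] alone reaches
    [Rv']. *)
Lemma side_reaches_src' : reaches psrc X Rv'.
Proof.
have [y0 y0O] := OEv0'.
pose Y := X :|: incident Ev'.
have fY : comps pface (~: Y) <= 1.
  suff to g : connect (link pface (~: Y)) g None.
    by apply: comps_le1 => g h; apply: connect_trans (to g) _; rewrite link_sym.
  have [s sR gs] := side_reaches_face g; apply: (@connect_trans _ _ s).
    apply: connect_mono gs; apply/subsetP=> e.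
    by rewrite inB in_setC in_setU negb_or => /and3P[_ -> ->].
  rewrite link_sym; apply: connect_mono (side_faces_connected sd sR).
  by rewrite -disjoints_subset disjoint_sym -setI_eq0 setIUl !disjoint_setI0 ?setU0 // disjoint_sym.
have cY : comps psrc Y <= n.+1.
  have := comps_dual (@balanced_face_src G) (~: Y) con; rewrite setCK.
  have := orients_card oX; rewrite card_roots.
  have := cardsC Y; rewrite card_disjointU // (card_incident sd').
  have := euler => /=; lia.
have YE : [disjoint Y & incident Ev].
  by rewrite -setI_eq0 setIUl !disjoint_setI0 ?setU0 // disjoint_sym.
have y0E : y0 \notin Ev by rewrite (disjointFr O'Ev).
have conY x : x \notin Ev -> connect (link psrc Y) y0 x.
  move=> xE; apply/negPn/negP=> nxy.
  suff: #|x |: (y0 |: Ev)| <= n.+1.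
    rewrite !cardsU1 !in_setU1 !negb_or y0E xE (card_even sd) andbT.
    by case: eqVneq nxy => [->|_]; rewrite ?connect0 // ltnn.
  apply: leq_trans cY; apply: comps_ge.
  have iso u w : u \in Ev -> connect (link psrc Y) u w -> w = u.
    move=> uE uw; apply/set1P; apply: link_closed uw (set11 u) => d dY /set1P du.
    by have := incidentP (S := Ev) (d := d); rewrite du (disjointFr YE) // => /(_ uE).
  have isor u w : u \in Ev -> connect (link psrc Y) w u -> w = u.
    by rewrite link_sym; exact: iso.
  move=> u w; rewrite !in_setU1.
  case/or3P=> [/eqP->|/eqP->|uE] /or3P[/eqP->|/eqP->|wE] //;
    try by [move=> /(isor _ _ wE) | move=> /(iso _ _ uE)].
  by rewrite link_sym => c; rewrite c in nxy.
  by move=> c; rewrite c in nxy.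
move=> x; have [xE|xE] := boolP (x \in Ev).
  by exists x; rewrite ?connect0 // in_setU xE orbT.
pose Z := [set x | [exists s in Rv', connect (link psrc X) x s]].
suff: x \in Z by rewrite inE => /exists_inP[s sR xs]; exists s.
apply: link_closed (conY x xE) _ => [d dY|]; last first.
  by rewrite inE; apply/exists_inP; exists y0; rewrite ?connect0 // !in_setU y0O.
rewrite !inE => /exists_inP[s sR ds]; apply/exists_inP.
have [dE|dE] := boolP (d.1 \in incident Ev').
  exists (src (opp d)); rewrite ?connect0 // in_setU (incident_src sd') //.
exists s => //; apply: connect_trans ds; rewrite link_sym; apply/connect1/link_dart.
by move: dY; rewrite in_setU (negPf dE) orbF.
Qed.

End Sides.

(** * Perfect matchings as pairs of orientations *)

Section Matchings.
Variable G : plane_graph.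
Implicit Types (Es M : {set hpair G}) (Vs : {set hvert G}) (e : edge G).

Lemma card1P (T : finType) (A : {set T}) :
  reflect (exists2 x, x \in A & {in A, forall y, y = x}) (#|A| == 1).
Proof.
apply: (iffP cards1P) => [[x ->]|[x xA Ax]]; exists x; rewrite ?set11 //.
  by move=> y /set1P.
by apply/setP=> y; rewrite inE; apply/idP/eqP => [/Ax|->].
Qed.

(** Every edge runs from an edge-vertex to another sort of vertex, so a perfect matching is a
    bijection between the two parts of [Vs]. *)
Lemma perfect_matchingP Es Vs M :
  perfect_matching Es Vs M <->
  [/\ forall p, p \in M -> [/\ p \in Es, EV p.1 \in Vs & inl p.2 \in Vs],
      {in M &, injective fst}, {in M &, injective snd},
      forall e, EV e \in Vs -> exists z, (e, z) \in M &
      forall z, inl z \in Vs -> exists e, (e, z) \in M].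
Proof.
have memE p e : (EV e \in hends p) = (p.1 == e).
  by rewrite !inE orbF eq_sym.
have memZ p z : (inl z \in hends p) = (p.2 == z).
  by rewrite !inE eq_sym.
split.
  case/andP=> /subsetP sM /forall_inP one.
  have inM p : p \in M -> [/\ p \in Es, EV p.1 \in Vs & inl p.2 \in Vs].
    by move=> /sM; rewrite inE subUset !sub1set => /and3P[].
  split=> // [p q pM qM pq|p q pM qM pq|e /one|z /one].
  - have [_ eV _] := inM p pM; have /card1P[r _ uq] := one _ eV.
    have pr : p = r by apply: uq; rewrite inE memE pM eqxx.
    have -> : q = r by apply: uq; rewrite inE memE qM -pq eqxx.
    by [].
  - have [_ _ zV] := inM p pM; have /card1P[r _ uq] := one _ zV.
    have pr : p = r by apply: uq; rewrite inE memZ pM eqxx.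
    have -> : q = r by apply: uq; rewrite inE memZ qM -pq eqxx.
    by [].
  - by case/card1P=> -[e' z]; rewrite inE memE => /andP[pM /eqP <-] _; exists z.
  - by case/card1P=> -[e z']; rewrite inE memZ => /andP[pM /eqP <-] _; exists e.
case=> inM inj1 inj2 ex1 ex2; apply/andP; split.
  by apply/subsetP=> p /inM[pE eV zV]; rewrite inE pE subUset !sub1set eV.
apply/forall_inP=> -[z zV|e eV]; apply/card1P.
  have [e ez] := ex2 z zV; exists (e, z); first by rewrite inE ez memZ eqxx.
  move=> p; rewrite inE memZ => /andP[pM /eqP pz]; exact: inj2.
have [z ez] := ex1 e eV; exists (e, z); first by rewrite inE ez memE eqxx.
move=> p; rewrite inE memE => /andP[pM /eqP pe]; exact: inj1.
Qed.

(** The set [A] of the overview, the invariant shared by both sides. *)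
Definition kind M : {set edge G} := [set e | [exists x, (e, inl x) \in M]].

Lemma kindP M e : reflect (exists x, (e, inl x) \in M) (e \in kind M).
Proof. by rewrite inE; exact: existsP. Qed.

(** Inverse to [matching_orients]. The unbounded face is a root of the dual and has no face-vertex,
    so only faces [Some g] get matched. *)
Definition build (Rv : {set vert G}) (Rf : {set option (bface G)})
    (ov : vert G -> edge G) (of_ : option (bface G) -> edge G) : {set hpair G} :=
  [set p : hpair G | match p.2 with
                     | inl x => (x \notin Rv) && (ov x == p.1)
                     | inr g => (Some g \notin Rf) && (of_ (Some g) == p.1)
                     end].

Variables (C : {set edge G}) (Rv : {set vert G}) (Rf : {set option (bface G)}).
Variable Vs : {set hvert G}.
Hypothesis NRf : None \in Rf.
Hypothesis VsE : forall e, (EV e \in Vs) = (e \notin C).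
Hypothesis VsO : forall x : vert G, (OV x \in Vs) = (x \notin Rv).
Hypothesis VsF : forall g : bface G, (FV g \in Vs) = (Some g \notin Rf).

Lemma matching_kind_disjoint M :
  perfect_matching (hedges G) Vs M -> [disjoint kind M & C].
Proof.
case/perfect_matchingP=> inM _ _ _ _; rewrite disjoints_subset; apply/subsetP=> e.
by case/kindP=> x /inM[_]; rewrite VsE inE.
Qed.

Lemma matching_orients (e0 : edge G) M : perfect_matching (hedges G) Vs M ->
  exists ov of_, [/\ orients (@src G) (kind M) Rv ov,
    orients (@face G) (~: (C :|: kind M)) Rf of_ & M = build Rv Rf ov of_].
Proof.
move=> PM; have XC := matching_kind_disjoint PM.
case/perfect_matchingP: (PM) => inM inj1 inj2 ex1 ex2.
(* The default [e0] is met only at unmatched vertices and faces, which are roots. *)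
pose out z := odflt e0 [pick e | (e, z) \in M].
have outP e z : (e, z) \in M -> out z = e.
  move=> eM; rewrite /out; case: pickP => [e' e'M|/(_ e)]; last by rewrite eM.
  by have [] := inj2 _ _ e'M eM erefl.
have outV z : inl z \in Vs -> (out z, z) \in M.
  by move=> /ex2[e eM]; rewrite (outP e).
pose of_ F := if F is Some g then out (inr g) else e0.
exists (fun x => out (inl x)), of_; split; [split|split|].
- move=> x y; rewrite !inE -!VsO => /outV xM /outV yM oxy.
  by rewrite oxy in xM; have [] := inj1 _ _ xM yM erefl.
- apply/setP=> e; apply/imsetP/kindP => [[x]|[x xM]].
    by rewrite inE -VsO => /outV xM ->; exists x.
  exists x; last by rewrite (outP e).
  by have [_ _] := inM _ xM; rewrite -[inl (inl x)]/(OV x) VsO inE.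
- move=> x; rewrite -VsO => /outV/inM[]; rewrite inE => /existsP[b /eqP xb] _ _.
  by exists b.
- move=> F F'; rewrite !in_setC; case: F F' => [g|] [h|]; rewrite ?NRf // -!VsF => /outV gM /outV hM oxy.
  by rewrite /= in oxy; rewrite oxy in gM; have [->] := inj1 _ _ gM hM erefl.
- apply/setP=> e; rewrite in_setC in_setU negb_or; apply/imsetP/andP.
    case=> -[g|]; rewrite inE ?NRf // -VsF => /outV gM -> /=.
    have [_ eV _] := inM _ gM; rewrite VsE in eV; split=> //.
    apply/kindP=> -[x xM]; by have [] := inj1 _ _ xM gM erefl.
  case=> eC /kindP nk; have [[x|g] xM] := ex1 e (etrans (VsE e) eC).
    by case: nk; exists x.
  exists (Some g); last by rewrite /= (outP e).
  by have [_ _] := inM _ xM; rewrite -[inl (inr g)]/(FV g) VsF inE.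
- move=> [g|]; rewrite ?NRf // -VsF => /outV/inM[]; rewrite inE => /existsP[b /eqP gb] _ _.
  by exists b.
- apply/setP=> -[e z]; rewrite inE /=; apply/idP/idP => [eM|].
    have [_ _] := inM _ eM; case: z eM => [x|g] eM /=.
      by rewrite -[inl (inl x)]/(OV x) VsO => ->; rewrite (outP e) ?eqxx.
    by rewrite -[inl (inr g)]/(FV g) VsF => ->; rewrite (outP e) ?eqxx.
  case: z => [x|g] /andP[]; rewrite -?VsO -?VsF => /outV + /eqP oe; by rewrite oe.
Qed.

Lemma build_kind (X : {set edge G}) ov of_ : orients (@src G) X Rv ov -> kind (build Rv Rf ov of_) = X.
Proof.
move=> oX; apply/setP=> e; apply/kindP/idP => [[x]|eX].
  by rewrite inE /= => /andP[xR /eqP <-]; exact: orients_in oX xR.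
have [_ oimg _] := oX; move: eX; rewrite -oimg => /imsetP[x xR ->].
by exists x; rewrite inE /= eqxx andbT; rewrite inE in xR.
Qed.

Lemma build_matching (X : {set edge G}) ov of_ : [disjoint X & C] ->
  orients (@src G) X Rv ov -> orients (@face G) (~: (C :|: X)) Rf of_ ->
  perfect_matching (hedges G) Vs (build Rv Rf ov of_).
Proof.
move=> XC oX oB; apply/perfect_matchingP.
have [ovinj ovimg ovinc] := oX; have [ofinj ofimg ofinc] := oB.
have oXC x : x \notin Rv -> ov x \notin C.
  by move=> xR; rewrite (disjointFr XC) ?(orients_in oX).
have ofXC g : g \notin Rf -> of_ g \notin C /\ of_ g \notin X.
  by move=> /(orients_in oB); rewrite in_setC in_setU negb_or => /andP[].
split.
- move=> [e [x|g]]; rewrite inE /= => /andP[xR /eqP <-].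
    rewrite VsE -[inl (inl x)]/(OV x) VsO xR (oXC x xR) inE /=; split=> //.
    by have [b xb] := ovinc x xR; apply/existsP; exists b; rewrite xb.
  have [eC _] := ofXC _ xR.
  rewrite VsE -[inl (inr g)]/(FV g) VsF xR eC inE /=; split=> //.
  by have [b xb] := ofinc _ xR; apply/existsP; exists b; rewrite xb.
- move=> [e [x|g]] [e' [y|h]]; rewrite !inE /= => /andP[xR /eqP xe] /andP[yR /eqP ye] ee'.
  + by rewrite ee' (ovinj x y) ?in_setC // xe ye.
  + have [_] := ofXC _ yR; by rewrite ye -ee' -xe (orients_in oX).
  + have [_] := ofXC _ xR; by rewrite xe ee' -ye (orients_in oX).
  + suff [->]: Some g = Some h by rewrite ee'.
    by apply: ofinj; rewrite ?in_setC // xe ye.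
- move=> [e z] [e' z']; rewrite !inE /= => zP z'P zz'; move: zP z'P; rewrite -zz'.
  by case: z {zz'} => [x|g] /andP[_ /eqP <-] /andP[_ /eqP <-].
- move=> e; rewrite VsE => eC; have [|eX] := boolP (e \in X).
    rewrite -ovimg => /imsetP[x xR ->]; exists (inl x).
    by rewrite inE /= eqxx andbT; rewrite inE in xR.
  have: e \in ~: (C :|: X) by rewrite in_setC in_setU negb_or eC.
  rewrite -ofimg => /imsetP[[g|]]; rewrite in_setC ?NRf // => gR ->; exists (inr g).
  by rewrite inE /= eqxx andbT.
- move=> [x|g]; [rewrite -[inl (inl x)]/(OV x) VsO => xR; exists (ov x)|
                 rewrite -[inl (inr g)]/(FV g) VsF => gR; exists (of_ (Some g))];
  by rewrite inE /= eqxx andbT.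
Qed.

(** Each edge outside [C] is matched exactly once, and its factor depends only on whether its
    partner is a vertex or a face. *)
Lemma mweight_kind (R : comPzSemiRingType) (w wd : edge G -> R) M :
  perfect_matching (hedges G) Vs M ->
  mweight w wd M = (\prod_(e in ~: C)
    if e \in kind M then w e else if borders e None then 1 else wd e)%R.
Proof.
case/perfect_matchingP=> inM inj1 _ ex1 _.
have -> : ~: C = [set p.1 | p in M].
  apply/setP=> e; rewrite in_setC -VsE; apply/idP/imsetP => [/ex1[z eM]|[p /inM[_ eV _] ->] //].
  by exists (e, z).
rewrite big_imset //=; apply: eq_bigr => -[e z] eM; rewrite /hweight /=.
case: z eM => [x|g] eM; first by rewrite (introT (kindP M e)) //; exists x.
by case: kindP => // -[x xM]; have [] := inj1 _ _ eM xM erefl.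
Qed.

End Matchings.

(** * Matchings of equal kind in the two graphs *)

Section Transfer.
Variable G : plane_graph.
Implicit Types (M : {set hpair G}).

Lemma eq_build (Rv : {set vert G}) (Rf : {set option (bface G)}) ov of_ ov' of_' :
  {in ~: Rv, ov =1 ov'} -> {in ~: Rf, of_ =1 of_'} ->
  build Rv Rf ov of_ = build Rv Rf ov' of_'.
Proof.
move=> eqv eqf; apply/setP=> -[e [x|g]]; rewrite !inE /=.
  by case: (boolP (x \in Rv)) => //= xR; rewrite eqv ?inE.
by case: (boolP (Some g \in Rf)) => //= gR; rewrite eqf ?inE.
Qed.

Variables (n : nat) (O Ev O' Ev' : {set vert G}) (Rf Rf' : {set option (bface G)}).
Hypotheses (sd : side n O Ev Rf) (sd' : side n O' Ev' Rf').
Hypotheses (EvEv' : [disjoint Ev & Ev']) (OEv' : [disjoint O & Ev']).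
Hypotheses (O'Ev : [disjoint O' & Ev]).
Hypothesis incEv : [disjoint incident Ev & incident Ev'].
Variables (C : {set edge G}) (Vs Vs' : {set hvert G}) (e0 : edge G).
Hypothesis CE : C = incident Ev :|: incident Ev'.
Hypothesis VsE : forall e, (EV e \in Vs) = (e \notin C).
Hypothesis VsO : forall x : vert G, (OV x \in Vs) = (x \notin O :|: Ev :|: Ev').
Hypothesis VsF : forall g : bface G, (FV g \in Vs) = (Some g \notin Rf).
Hypothesis VsE' : forall e, (EV e \in Vs') = (e \notin C).
Hypothesis VsO' : forall x : vert G, (OV x \in Vs') = (x \notin O' :|: Ev' :|: Ev).
Hypothesis VsF' : forall g : bface G, (FV g \in Vs') = (Some g \notin Rf').

(** Both matchings orient the same two edge sets towards the same roots, and such orientations are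
    unique. *)
Lemma kind_inj M M' :
  perfect_matching (hedges G) Vs M -> perfect_matching (hedges G) Vs M' ->
  kind M = kind M' -> M = M'.
Proof.
move=> PM PM' kMM'; have NR := side_None sd.
have XC := matching_kind_disjoint VsE PM; rewrite CE in XC.
have [ov [of_ [oX oB ->]]] := matching_orients NR VsE VsO VsF e0 PM.
have [ov' [of_' [oX' oB' ->]]] := matching_orients NR VsE VsO VsF e0 PM'.
rewrite -kMM' in oX' oB'.
have BE : ~: (C :|: kind M) = ~: (incident Ev :|: incident Ev' :|: kind M) by rewrite CE.
have rv := side_reaches_src sd sd' EvEv' OEv' O'Ev incEv oX oB BE XC.
have rf := side_reaches_face sd sd' EvEv' OEv' O'Ev incEv oX oB BE XC.
have [o _ oU] := reaches_orients e0 rv (orients_card oX).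
have [h _ hU] := reaches_orients e0 rf (orients_card oB).
by apply: eq_build => x xR; rewrite ?(oU _ oX) ?(oU _ oX') ?(hU _ oB) ?(hU _ oB').
Qed.

(** The root counts agree on both sides, so the same edge sets can be reoriented towards the primed
    roots once these are reached. *)
Lemma kind_transfer M : perfect_matching (hedges G) Vs M ->
  exists2 M', perfect_matching (hedges G) Vs' M' & kind M' = kind M.
Proof.
move=> PM; have NR := side_None sd.
have XC := matching_kind_disjoint VsE PM; have XC' := XC; rewrite CE in XC'.
have [ov [of_ [oX oB _]]] := matching_orients NR VsE VsO VsF e0 PM.
have BE : ~: (C :|: kind M) = ~: (incident Ev :|: incident Ev' :|: kind M) by rewrite CE.
have rv := side_reaches_src' sd sd' EvEv' OEv' O'Ev incEv oX oB BE XC'.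
have rf := side_reaches_face' sd sd' EvEv' OEv' O'Ev incEv oX oB BE XC'.
have Ev'Ev : [disjoint Ev' & Ev] by rewrite disjoint_sym.
have := orients_card oX; rewrite (card_roots sd sd') // -(card_roots sd' sd) // => cv.
have := orients_card oB; rewrite (card_side_faces sd) -(card_side_faces sd') => cf.
have [o oP _] := reaches_orients e0 rv cv; have [h hP _] := reaches_orients e0 rf cf.
exists (build (O' :|: Ev' :|: Ev) Rf' o h); last exact: build_kind oP.
exact (build_matching (side_None sd') VsE' VsO' VsF' XC oP hP).
Qed.

End Transfer.

Lemma bijection_of_kind (R : comPzSemiRingType) (G : plane_graph) (w wd : edge G -> R)
    (X Y : {set {set hpair G}}) :
  {in X &, injective (@kind G)} -> {in Y &, injective (@kind G)} ->
  (forall M, M \in X -> exists2 M', M' \in Y & kind M' = kind M) ->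
  (forall M, M \in Y -> exists2 M', M' \in X & kind M' = kind M) ->
  (forall M M', M \in X -> M' \in Y -> kind M' = kind M -> mweight w wd M' = mweight w wd M) ->
  weight_preserving_bijection w wd X Y.
Proof.
move=> injX injY XY YX wE.
pose phi M := odflt M [pick M' in Y | kind M' == kind M].
have phiP M : M \in X -> phi M \in Y /\ kind (phi M) = kind M.
  move=> /XY[M' M'Y kM]; rewrite /phi; case: pickP => [M1 /andP[? /eqP]|/(_ M')] //=.
  by rewrite M'Y kM eqxx.
exists phi; split=> [M M' MX M'X pMM'||M MX].
- by apply: injX => //; have [_ <-] := phiP M MX; have [_ <-] := phiP M' M'X; rewrite pMM'.
- apply/setP=> M; apply/imsetP/idP => [[M' /phiP[M'Y _] -> //]|MY].
  have [M' M'X kM] := YX M MY; exists M' => //; have [pY pk] := phiP M' M'X.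
  by apply: injY => //; rewrite pk.
- by have [pY pk] := phiP M MX; exact: wE.
Qed.

(** * Matchings along a path *)

Section PathMatchings.
Variables (G : plane_graph) (T : finType) (j : T -> vert G + bface G).
Variable lk : edge G -> rel T.
Hypothesis lkE : forall e y z, lk e y z ->
  forall t, ((e, j t) \in hedges G) = (t == y) || (t == z).
Hypothesis lk_sym : forall e, symmetric (lk e).
Implicit Types (s : seq (edge G * T)) (M : {set hpair G}).

(** One treatment for paths in the graph and in the dual: [j] injects vertices or bounded faces, and
    [K] below collects the edges matched to that sort. *)
Let c (t : T) : hvert G := inl (j t).

Lemma subdivision_cons x e y s :
  subdivision c x ((e, y) :: s) = [:: c x, EV e & subdivision c y s].
Proof. by []. Qed.

Lemma subdivision_rcons x s e y :
  subdivision c x (rcons s (e, y)) = subdivision c x s ++ [:: EV e; c y].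
Proof. by elim: s x => // -[e' z] s IH x; rewrite rcons_cons !subdivision_cons IH. Qed.

Lemma walk_rcons x s e y :
  walk lk x (rcons s (e, y)) = walk lk x s && lk e (last x (unzip2 s)) y.
Proof. by elim: s x => [|[e' z] s IH] x /=; rewrite ?andbT // IH andbA. Qed.

Lemma walk_rev x s : walk lk x s -> exists s',
  [/\ walk lk (last x (unzip2 s)) s', last (last x (unzip2 s)) (unzip2 s') = x,
      last x (unzip2 s) :: unzip2 s' = rev (x :: unzip2 s),
      unzip1 s' = rev (unzip1 s) &
      subdivision c (last x (unzip2 s)) s' = rev (subdivision c x s)].
Proof.
elim: s x => [|[e y] s IH] x /=; first by exists [::].
case/andP=> exy /IH[s' [wk lst v2 v1 sub]]; exists (rcons s' (e, x)).
rewrite walk_rcons wk lst lk_sym exy /unzip1 /unzip2 !map_rcons last_rcons.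
rewrite subdivision_rcons sub subdivision_cons; split=> //.
- by rewrite -rcons_cons v2 [in RHS]rev_cons.
- by rewrite -/(unzip1 s') v1 [in RHS]rev_cons.
- by rewrite [in RHS]rev_cons [in RHS]rev_cons -!cats1 -catA.
Qed.

Lemma mem_subdivision_tail x s a :
  reflect (exists2 q, q \in s & a = EV q.1 \/ a = c q.2)
          (a \in del_start (subdivision c x s)).
Proof.
apply: (iffP flatten_mapP) => -[q qs]; rewrite ?inE.
  by case/orP=> /eqP ->; exists q; auto.
by case=> ->; exists q => //; rewrite !inE eqxx ?orbT.
Qed.

Variables (Vs : {set hvert G}) (M : {set hpair G}) (K : {set edge G}).
Hypothesis PM : perfect_matching (hedges G) Vs M.
Hypothesis KP : forall e, reflect (exists t, (e, j t) \in M) (e \in K).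

(** The first edge is not matched backwards, hence forwards; this occupies its far end, and the next
    edge is in the same situation. *)
Lemma walk_matched x s : walk lk x s -> uniq (x :: unzip2 s) ->
  {subset unzip1 s <= K} ->
  (forall q, ohead s = Some q -> (q.1, j x) \notin M) ->
  forall q, q \in s -> (q.1, j q.2) \in M.
Proof.
have [inM inj1 inj2 _ _] := (perfect_matchingP _ _ _).1 PM.
elim: s x => // -[e y] s IH x /= /andP[exy sw] /andP[xs uq] sK hd.
have eyM : (e, j y) \in M.
  have /KP[t etM] : e \in K by apply: sK; rewrite mem_head.
  have [etE _ _] := inM _ etM; move: etE; rewrite (lkE exy) => /orP[]/eqP tE.
    by have := hd _ erefl; rewrite /= -tE etM.
  by rewrite -tE.
move=> q; rewrite inE => /orP[/eqP-> //|]; apply: (IH y sw uq _ _ q) => // {q}.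
  by move=> e' e's; apply: sK; rewrite inE e's orbT.
(* If the next edge [e'] were matched to [y], then [e' = e], and [x] would be [y] or [z], against
   the simplicity of the path. *)
case: s sw xs {IH uq sK} => //= -[e' z] s /andP[eyz _] xs _ [<-] /=.
apply/negP=> e'M; have [ee'] := inj2 _ _ e'M eyM erefl.
have [inH _ _] := inM _ eyM.
have := lkE exy x; rewrite eqxx /= -ee' (lkE eyz) => /orP[]/eqP xE.
  by move: xs; rewrite xE mem_head.
by move: xs; rewrite xE !inE eqxx orbT.
Qed.

(** Without its start, the path is matched by pairing each edge-vertex with the next vertex. As the
    start is missing from [Vs], membership of all edges in [K] already forces this direction. *)
Lemma contains_path_matching_start x s : inl (j x) \notin Vs ->
  walk lk x s -> uniq (x :: unzip2 s) ->
  contains_path_matching (del_start (subdivision c x s)) M = all (mem K) (unzip1 s).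
Proof.
move=> xV sw uq; have [inM inj1 inj2 _ _] := (perfect_matchingP _ _ _).1 PM.
apply/existsP/allP => [[N /andP[PN /subsetP NM]] e /mapP[q qs ->]|sK].
  have [inN _ _ exN _] := (perfect_matchingP _ _ _).1 PN.
  have [|z qN] := exN q.1.
    by rewrite inE; apply/mem_subdivision_tail; exists q; auto.
  have [_ _] := inN _ qN; rewrite inE => /mem_subdivision_tail[q' _ []] //= [zE].
  by apply/KP; exists q'.2; rewrite -zE NM.
have sM := walk_matched sw uq sK.
have {}sM q : q \in s -> (q.1, j q.2) \in M.
  by apply: sM => q' _; apply: contra xV => /inM[].
pose N := [set p | p \in [seq (q.1, j q.2) | q <- s]].
have NP p : reflect (exists2 q, q \in s & p = (q.1, j q.2)) (p \in N).
  by rewrite inE; exact: mapP.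
have NM p : p \in N -> p \in M by case/NP=> q /sM qM ->.
exists N; apply/andP; split; last exact/subsetP.
apply/perfect_matchingP; split.
- move=> _ /NP[q qs ->]; have [qE _ _] := inM _ (sM _ qs).
  split; try by rewrite inE; apply/mem_subdivision_tail; exists q; auto.
  rewrite /path_edges in_set qE /=.
  apply/orP; left; case/splitPr: qs => s1 s2.
  apply/infixP; exists (flatten [seq [:: EV p.1; c p.2] | p <- s1]),
    (flatten [seq [:: EV p.1; c p.2] | p <- s2]).
  by rewrite /del_start /= map_cat flatten_cat.
- by move=> p q /NM pM /NM; exact: inj1.
- by move=> p q /NM pM /NM; exact: inj2.
- move=> e; rewrite inE => /mem_subdivision_tail[q qs []] // [->].
  by exists (j q.2); apply/NP; exists q.
- move=> z; rewrite inE => /mem_subdivision_tail[q qs []] // [->].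
  by exists q.1; apply/NP; exists q.
Qed.

Lemma contains_path_matching_rev (P : seq (hvert G)) :
  contains_path_matching (rev P) M = contains_path_matching P M.
Proof.
apply: eq_existsb => N.
have -> : path_edges (rev P) = path_edges P.
  apply/setP=> p; rewrite !inE; congr (_ && _).
  by rewrite -[[:: EV p.1; _]]revK -[[:: inl p.2; _]]revK !infix_rev orbC.
by have -> : [set a in rev P] = [set a in P] by apply/setP=> a; rewrite !inE mem_rev.
Qed.

(** Reversing the path reduces this to the case of a deleted start, with the same condition on
    [K]. *)
Lemma contains_path_matching_end x s : inl (j (last x (unzip2 s))) \notin Vs ->
  walk lk x s -> uniq (x :: unzip2 s) ->
  contains_path_matching (del_end (subdivision c x s)) M = all (mem K) (unzip1 s).
Proof.
move=> yV /walk_rev[s' [sw _ v2 v1 sub]] uq.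
rewrite /del_end contains_path_matching_rev -sub -/(del_start _).
by rewrite (contains_path_matching_start yV sw) ?v1 ?all_rev // v2 rev_uniq.
Qed.

End PathMatchings.

Lemma val_odd_ix n (i : 'I_n.+1) : odd_ix i = i.*2 :> nat.
Proof. by rewrite inordK // ltnS leq_double -ltnS. Qed.

Lemma val_even_ix n (i : 'I_n) : even_ix i = i.*2.+1 :> nat.
Proof. by rewrite inordK // ltnS ltn_double. Qed.

Lemma odd_even_ix n (k : 'I_n.*2.+1) :
  (exists i, k = odd_ix i) \/ (exists i, k = even_ix i).
Proof.
have := ltn_ord k; have := odd_double_half k; case: (odd k) => kE kn.
  have kn2 : k./2 < n by lia.
  by right; exists (Ordinal kn2); apply/val_inj; rewrite /= val_even_ix.
have kn2 : k./2 < n.+1 by lia.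
by left; exists (Ordinal kn2); apply/val_inj; rewrite /= val_odd_ix.
Qed.

(** * Outer paths whose even vertices have degree two *)

Section OuterPath.
Variable G : plane_graph.
Local Notation dart := (edge G * bool)%type.
Implicit Types (d a b : dart) (x : vert G).

Lemma degree2_darts x d a b : degree x = 2 -> src a = x -> src b = x -> a != b ->
  src d = x -> d = a \/ d = b.
Proof.
move=> x2 ax bx ab dx.
have sub : [set a; b] \subset [set d | src d == x].
  by apply/subsetP=> c; rewrite !inE => /orP[]/eqP->; rewrite ?ax ?bx.
have /eqP E : [set a; b] == [set d | src d == x].
  by rewrite eqEcard sub cards2 ab -[#|[set d | _]|]/(degree x) x2.
by have := in_set2 d a b; rewrite E inE dx eqxx => /esym/orP[]/eqP->; auto.
Qed.

Lemma lies_on_dart x F : 0 < degree x -> lies_on x F -> exists2 d, src d = x & face d = F.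
Proof.
move=> x0; rewrite /lies_on -[degree x == 0]negbK -lt0n x0 orbF.
by case/existsP=> d /andP[/eqP dx /eqP dF]; exists d.
Qed.

(** [rot] exchanges the two darts at [x], since a fixed dart would be a whole orbit, against
    [rot_cyclic]. So the left face of either dart is the right face of the other. *)
Lemma degree2_faces x a g d : degree x = 2 -> src a = x -> face a = None ->
  lies_on x (Some g) -> src d = x ->
  face d = None /\ face (opp d) = Some g \/ face d = Some g /\ face (opp d) = None.
Proof.
move=> x2 ax aN /lies_on_dart; rewrite x2 => /(_ isT)[b bx bg] dx.
have ab : a != b by apply/eqP=> ab; rewrite ab bg in aN.
have rotE c c' : src c = x -> src c' = x -> c != c' -> rot c = c'.
  move=> cx cx' cc'.
  have [|//] : rot c = c \/ rot c = c'.
    by apply: (degree2_darts x2 cx cx' cc'); rewrite src_rot.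
  move=> cfix; have := rot_cyclic (etrans cx (esym cx')); move/iter_findex.
  rewrite iter_fix // => E; by rewrite E eqxx in cc'.
have [->|->] := degree2_darts x2 ax bx ab dx; rewrite -face_rot.
  by left; rewrite (rotE a b).
by right; rewrite (rotE b a) // eq_sym.
Qed.

Variables (n : nat) (v : 'I_n.*2.+1 -> vert G) (f : 'I_n -> bface G).
Hypothesis v_path : is_path (codom v).
Hypothesis v_outer : forall k, exists2 d, src d = v k & face d = None.
Hypothesis v_deg2 : forall i, degree (v (even_ix i)) = 2.
Hypothesis v_face : forall i, lies_on (v (even_ix i)) (Some (f i)).
Hypothesis f_inj : injective f.

Definition odd_set : {set vert G} := [set v (odd_ix i) | i : 'I_n.+1].
Definition even_set : {set vert G} := [set v (even_ix i) | i : 'I_n].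
Definition side_faces : {set option (bface G)} := None |: [set Some (f i) | i : 'I_n].

Lemma v_inj : injective v.
Proof. by apply/injectiveP; case/andP: v_path. Qed.

Lemma v_adj k : k < n.*2 -> exists2 d, src d = v (inord k) & src (opp d) = v (inord k.+1).
Proof.
move=> kn; have /andP[/(sortedP (v ord0)) adj _] := v_path.
have nthE m : m <= n.*2 -> nth (v ord0) (codom v) m = v (inord m).
  move=> mn; rewrite codomE (nth_map ord0) ?size_enum_ord //; congr v.
  by apply/val_inj; rewrite /= nth_enum_ord // inordK.
have := adj k; rewrite size_codom card_ord !nthE //; last exact: ltnW.
move=> /(_ kn)/existsP[e /existsP[b /andP[/eqP eb /eqP eb']]].
by exists (e, b).
Qed.

Lemma even_dart d i : src d = v (even_ix i) ->
  face d = None /\ face (opp d) = Some (f i) \/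
  face d = Some (f i) /\ face (opp d) = None.
Proof.
have [a ax aN] := v_outer (even_ix i).
exact: (degree2_faces (v_deg2 i) ax aN (v_face i)).
Qed.

Lemma incident_evenP d : d.1 \in incident even_set ->
  exists i, src d = v (even_ix i) \/ src (opp d) = v (even_ix i).
Proof.
case: d => e b; rewrite inE => /existsP[b' /imsetP[i _ E]]; exists i.
by case: (eqVneq b' b) => [<-|]; [left|case: b b' E => -[] //; right].
Qed.

Lemma mem_side_set k : v k \in odd_set :|: even_set.
Proof.
by have [[i ->]|[i ->]] := odd_even_ix k; rewrite in_setU imset_f ?orbT.
Qed.

Lemma side_setP x : x \in odd_set :|: even_set -> exists k, x = v k.
Proof. by rewrite in_setU => /orP[]/imsetP[i _ ->]; eexists. Qed.

Lemma even_index (i : 'I_n) : v (even_ix i) = v (inord i.*2.+1).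
Proof. by []. Qed.

Lemma card_even_set : #|even_set| = n.
Proof.
rewrite card_imset ?card_ord // => i k /v_inj/(congr1 val)/=; rewrite !val_even_ix => E.
by apply/val_inj => /=; lia.
Qed.

(** Each of the [n] even vertices has two darts, and no two of all these share an edge: an edge with
    ends at even vertices [i] and [k] would have the one bounded side [f i = f k], so [i = k] and it
    would be a loop. *)
Lemma card_incident_even : #|incident even_set| = n.*2.
Proof.
pose D := [set d | src d \in even_set].
have -> : incident even_set = [set d.1 | d in D].
  apply/setP=> e; rewrite inE; apply/existsP/imsetP => [[b eb]|[[e' b]]].
    by exists (e, b); rewrite ?inE.
  by rewrite inE => eb ->; exists b.
rewrite card_in_imset.
  rewrite -sum1_card (partition_big (@src G) (mem even_set)) /=; last by move=> d; rewrite inE.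
  transitivity (\sum_(x in even_set) 2); last first.
    by rewrite sum_nat_const card_even_set muln2.
  apply: eq_bigr => x xE; have /imsetP[i _ xi] := xE.
  rewrite -(v_deg2 i) -xi /degree -sum1_card; apply: eq_bigl => d.
  by rewrite !inE; case: eqP => [->|]; rewrite ?xE ?andbF.
move=> [e b] [e' b']; rewrite !inE /= => /imsetP[i _ eb] /imsetP[k _ eb'] ee'.
rewrite -{e'}ee' in eb' *; case: (eqVneq b b') => [->//|bb'].
have bE : b' = ~~ b by case: b b' bb' {eb eb'} => -[].
have noloop := no_loop e.
have ik : i = k.
  apply: f_inj; have [[b1 b2]|[b1 b2]] := even_dart eb;
    have [[c1 c2]|[c1 c2]] := even_dart eb'; rewrite /opp /= bE ?negbK in b1 b2 c1 c2;
    rewrite ?b1 ?b2 // in c1 c2; by [case: c1|case: c2].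
move: noloop; rewrite bE -ik -eb in eb' *.
by case: (b) eb' => /= ->; rewrite eqxx.
Qed.

Lemma outer_path_side : side n odd_set even_set side_faces.
Proof.
(* One of two consecutive indices is odd, and with indices from 0 these are the ones of the even
   vertices. *)
have inc k : k < n.*2 -> exists2 d, src d = v (inord k) & 
    src (opp d) = v (inord k.+1) /\ d.1 \in incident even_set.
  move=> kn; have [d dk dk'] := v_adj kn; exists d => //; split=> //.
  have ev m : m < n.*2.+1 -> odd m -> v (inord m) \in even_set.
    move=> mn mo; have m2 : m./2 < n by have := odd_double_half m; lia.
    apply/imsetP; exists (Ordinal m2) => //; rewrite even_index /=.
    by have := odd_double_half m; rewrite mo add1n => ->.
  have [ko|ko] := boolP (odd k).
    by apply: incidentP; rewrite dk ev // ltnW.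
  by apply: (@incidentP _ _ (opp d)); rewrite dk' ev.
have con k : k < n.*2.+1 -> connect (link (@src G) (incident even_set)) (v ord0) (v (inord k)).
  elim: k => [_|k IH kn].
    by have -> : inord 0 = ord0 :> 'I_n.*2.+1; [apply/val_inj; rewrite /= inordK|exact: connect0].
  apply: connect_trans (IH (ltnW kn)) _; have [d <- [<- dE]] := inc k kn.
  exact/connect1/link_dart.
split.
- rewrite card_imset ?card_ord // => i k /v_inj/(congr1 val)/=; rewrite !val_odd_ix => E.
  by apply/val_inj => /=; lia.
- exact: card_even_set.
- rewrite cardsU1 card_imset ?card_ord; last by move=> i k [/f_inj].
  by case: imsetP => [[]|].
- apply/pred0P=> x /=; apply/negP=> /andP[/imsetP[i _ ->] /imsetP[k _ /v_inj/(congr1 val)]] /=.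
  by rewrite val_even_ix val_odd_ix; lia.
- exact: card_incident_even.
- by move=> x /side_setP[k ->].
- have to0 x : x \in odd_set :|: even_set ->
    connect (link (@src G) (incident even_set)) (v ord0) x.
    by case/side_setP=> k ->; rewrite -[k]inord_val; apply: con.
  by move=> x y /to0 x0 /to0; apply: connect_trans; rewrite link_sym.
- exact: setU11.
- move=> g; rewrite in_setU1 => /orP[/eqP->|/imsetP[i _ ->]]; first exact: connect0.
  have [a ax aN] := v_outer (even_ix i).
  have [[_ <-]|[]] := even_dart ax; last by rewrite aN.
  rewrite -aN; apply/connect1/link_dart/incidentP.
  by rewrite ax imset_f.
(* The two darts at an even vertex are those of its two path edges, so their far ends lie on the
   path. *)
- move=> d /incident_evenP[i [->|di]]; first exact: mem_side_set.
  have in2 := ltn_ord i.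
  have i1 : i.*2 < n.*2 by rewrite ltn_double.
  have i2 : i.*2.+1 < n.*2 by lia.
  have [a ai [ai' _]] := inc _ i1; have [b bi [bi' _]] := inc _ i2.
  have ab : opp a != b.
    apply/eqP=> ab; move: bi'; rewrite -ab oppK ai => /v_inj/(congr1 val) /=.
    by rewrite !inordK; lia.
  have [oE|oE] := degree2_darts (v_deg2 i) ai' bi ab di.
    by rewrite -[d]oppK oE oppK ai mem_side_set.
  by rewrite -[d]oppK oE bi' mem_side_set.
- move=> d /incident_evenP[i [/even_dart|/even_dart]]; rewrite ?oppK => -[] [E E'];
    by rewrite ?E ?E' in_setU1 ?eqxx // imset_f ?orbT.
Qed.

End OuterPath.

(** * Visits of the outer boundary walk *)

Section OuterBoundary.
Variable G : plane_graph.
Local Notation dart := (edge G * bool)%type.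

Lemma outer_boundary_dart (s : seq (vert G)) x :
  ccw_on_outer_boundary s -> x \in s -> exists2 d : dart, src d = x & face d = None.
Proof.
case=> d [c [dN /mem_subseq cO <-]] /mapP[a /cO aO ->]; exists a => //.
move: aO; rewrite -fconnect_orbit => /iter_findex <-.
by rewrite -dN; elim: (findex _ _ _) => // k IH; rewrite iterS face_stepE.
Qed.

(* Two visits would put both corners of [x] on the unbounded face. *)
Lemma outer_boundary_once (s s' : seq (vert G)) x g :
  ccw_on_outer_boundary (s ++ s') -> degree x = 2 -> lies_on x (Some g) ->
  x \in s -> x \notin s'.
Proof.
case=> d [c [dN cO cE]] x2 xg xs; apply/negP=> xs'.
have cN a : a \in c -> face a = None.
  move=> /(mem_subseq cO); rewrite -fconnect_orbit => /iter_findex <-.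
  by rewrite -dN; elim: (findex _ _ _) => // k IH; rewrite iterS face_stepE.
have cU : uniq c by apply: subseq_uniq cO (orbit_uniq _ _).
have sE : map (@src G) (take (size s) c) = s by rewrite map_take cE take_size_cat.
have s'E : map (@src G) (drop (size s) c) = s' by rewrite map_drop cE drop_size_cat.
move: xs xs'; rewrite -sE -s'E => /mapP[a ac xa] /mapP[b bc xb].
have ab : a != b.
  apply/eqP=> ab; move: cU; rewrite -(cat_take_drop (size s) c) cat_uniq.
  by case/and3P=> _ /hasPn/(_ b bc) /=; rewrite -ab ac.
have [|a' xa' ag] := lies_on_dart _ xg; first by rewrite x2.
have [E|E] := degree2_darts x2 (esym xa) (esym xb) ab xa'; rewrite E cN // in ag.
  exact: mem_take ac.
exact: mem_drop bc.
Qed.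

End OuterBoundary.

(** * What remains after smashing and deleting the terminals *)

Section SmashedTerminals.
Variables (G : plane_graph) (n : nat) (v : 'I_n.*2.+1 -> vert G) (f : 'I_n -> bface G).
Variable S : {set vert G}.

Lemma EV_remaining (e : edge G) :
  (EV e \in smash S :\: terminals v f) = (e \notin incident S).
Proof.
rewrite in_setD [_ \in terminals _ _]in_setU.
have -> : (EV e \in [set OV (v (odd_ix i)) | i : 'I_n.+1]) = false by apply/imsetP=> -[].
have -> : (EV e \in [set FV (f i) | i : 'I_n]) = false by apply/imsetP=> -[].
rewrite in_setC in_setU.
have -> : (EV e \in [set OV x | x in S]) = false by apply/imsetP=> -[].
rewrite /=; congr negb; apply/imsetP/idP => [[e' + [->]]|eS].
  rewrite inE => /exists_inP[x xS]; rewrite inE => /existsP[b /eqP bx].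
  by rewrite inE; apply/existsP; exists b; rewrite bx.
exists e => //; move: eS; rewrite !inE => /existsP[b bS].
by apply/exists_inP; exists (src (e, b)); rewrite // inE; apply/existsP; exists b.
Qed.

Lemma OV_remaining (x : vert G) :
  (OV x \in smash S :\: terminals v f) = (x \notin odd_set v :|: S).
Proof.
rewrite in_setD [_ \in terminals _ _]in_setU in_setC !in_setU !negb_or.
have -> : (OV x \in [set FV (f i) | i : 'I_n]) = false by apply/imsetP=> -[].
have -> : (OV x \in [set EV e | e : edge G & [exists x in S, (e, inl x) \in hedges G]]) = false.
  by apply/imsetP=> -[].
rewrite !andbT; congr (~~ _ && ~~ _); last by apply: mem_imset => y z [].
by apply/imsetP/imsetP => [[i _ [->]]|[i _ ->]]; exists i.
Qed.

Lemma FV_remaining (g : bface G) :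
  (FV g \in smash S :\: terminals v f) = (Some g \notin side_faces f).
Proof.
rewrite in_setD [_ \in terminals _ _]in_setU in_setC !in_setU in_set1 !negb_or.
have -> : (FV g \in [set OV (v (odd_ix i)) | i : 'I_n.+1]) = false by apply/imsetP=> -[].
have -> : (FV g \in [set OV x | x in S]) = false by apply/imsetP=> -[].
have -> : (FV g \in [set EV e | e : edge G & [exists x in S, (e, inl x) \in hedges G]]) = false.
  by apply/imsetP=> -[].
rewrite !andbT /=; congr negb.
by apply/imsetP/imsetP => [[i _ [->]]|[i _ [->]]]; exists i.
Qed.

End SmashedTerminals.

(** * Paths in the graph and in its dual *)

Section PathKinds.
Variables (G : plane_graph) (Vs : {set hvert G}) (C : {set edge G}) (M : {set hpair G}).
Hypothesis PM : perfect_matching (hedges G) Vs M.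
Hypothesis VsE : forall e, (EV e \in Vs) = (e \notin C).

Lemma face_kindP e :
  reflect (exists g, (e, inr g) \in M) (e \in ~: (C :|: kind M)).
Proof.
have [inM inj1 _ ex1 _] := (perfect_matchingP _ _ _).1 PM.
rewrite in_setC in_setU negb_or; apply: (iffP andP) => [[eC ek]|[g eM]].
  have [[x|g] eM] := ex1 e (etrans (VsE e) eC); last by exists g.
  by case/kindP: ek; exists x.
have [_ eV _] := inM _ eM; rewrite VsE in eV; split=> //.
by apply/kindP=> -[x xM]; have [] := inj1 _ _ xM eM erefl.
Qed.

Lemma joins_hedges (e : edge G) y z : joins e y z ->
  forall t : vert G, ((e, inl t) \in hedges G) = (t == y) || (t == z).
Proof.
case/existsP=> b /andP[/eqP <- /eqP <-] t; rewrite inE /=.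
apply/existsP/orP => [[b' /eqP <-]|[]/eqP->]; last by exists (~~ b).
  by case: b b' => -[]; auto.
by exists b.
Qed.

Lemma dual_joins_hedges (e : edge G) y z : dual_joins e y z ->
  forall t : bface G, ((e, inr t) \in hedges G) = (t == y) || (t == z).
Proof.
case/existsP=> b /andP[/eqP by_ /eqP bz] t; rewrite inE /=.
apply/existsP/orP => [[b' /eqP bt]|[]/eqP->]; last by exists (~~ b); rewrite bz.
  move: bt; have [->|bb'] := eqVneq b' b; first by rewrite by_ => -[->]; auto.
  have -> : b' = ~~ b by case: b b' bb' {by_ bz} => -[].
  by rewrite bz => -[->]; auto.
by exists b; rewrite by_.
Qed.

Lemma joins_sym (e : edge G) : symmetric (@joins G e).
Proof.
move=> y z; apply/existsP/existsP => -[b /andP[? ?]]; exists (~~ b);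
  by rewrite negbK; apply/andP.
Qed.

Lemma dual_joins_sym (e : edge G) : symmetric (@dual_joins G e).
Proof.
move=> y z; apply/existsP/existsP => -[b /andP[? ?]]; exists (~~ b);
  by rewrite negbK; apply/andP.
Qed.

End PathKinds.

Section PathTransfer.
Variables (G : plane_graph) (Vs Vs' : {set hvert G}) (C : {set edge G}).
Variables M M' : {set hpair G}.
Hypothesis PM : perfect_matching (hedges G) Vs M.
Hypothesis PM' : perfect_matching (hedges G) Vs' M'.
Hypothesis VsE : forall e, (EV e \in Vs) = (e \notin C).
Hypothesis VsE' : forall e, (EV e \in Vs') = (e \notin C).
Hypothesis kMM' : kind M' = kind M.

(** Both conditions say that all edges of the path lie in the common kind; for dual paths it is the
    set of edges matched to faces. *)
Lemma primal_path_transfer P x y : is_primal_path P x y ->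
  OV x \notin Vs -> OV y \notin Vs' ->
  contains_path_matching (del_start P) M = contains_path_matching (del_end P) M'.
Proof.
case=> s /and3P[sw uq /eqP sy] -> xV yV; rewrite -sy in yV.
have st := contains_path_matching_start (@joins_hedges G) PM (kindP M) xV sw uq.
have en := contains_path_matching_end (@joins_hedges G) (@joins_sym G)
  PM' (kindP M') yV sw uq.
by apply: etrans st _; rewrite -kMM'; exact: esym en.
Qed.

Lemma dual_path_transfer P f g : is_dual_path P f g ->
  FV f \notin Vs -> FV g \notin Vs' ->
  contains_path_matching (del_start P) M = contains_path_matching (del_end P) M'.
Proof.
case=> s /and3P[sw uq /eqP sy] -> xV yV; rewrite -sy in yV.
have st := contains_path_matching_start (@dual_joins_hedges G) PM
  (face_kindP PM VsE) xV sw uq.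
have en := contains_path_matching_end (@dual_joins_hedges G) (@dual_joins_sym G)
  PM' (face_kindP PM' VsE') yV sw uq.
by apply: etrans st _; rewrite -kMM'; exact: esym en.
Qed.

End PathTransfer.

Lemma incidentU (G : plane_graph) (S S' : {set vert G}) :
  incident (S :|: S') = incident S :|: incident S'.
Proof.
apply/setP=> e; rewrite !inE; apply/existsP/orP => [[b]|[]/existsP[b bS]].
- by rewrite inE => /orP[bS|bS]; [left|right]; apply/existsP; exists b.
- by exists b; rewrite inE bS.
- by exists b; rewrite inE bS orbT.
Qed.

Theorem theorem5p1 (R : comPzSemiRingType) (G : plane_graph)
    (w wd : edge G -> R) (n : nat)
    (v v' : 'I_n.*2.+1 -> vert G) (f f' : 'I_n -> bface G)
    (G_leaf : no_inner_leaf G)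
    (v_path : is_path (codom v))
    (v'_path : is_path (codom v'))
    (vv'_order : ccw_on_outer_boundary (codom v ++ rev (codom v')))
    (v_deg2 : forall i : 'I_n, degree (v (even_ix i)) = 2)
    (v'_deg2 : forall i : 'I_n, degree (v' (even_ix i)) = 2)
    (v_face : forall i : 'I_n, lies_on (v (even_ix i)) (Some (f i)))
    (v'_face : forall i : 'I_n, lies_on (v' (even_ix i)) (Some (f' i)))
    (f_inj : injective f)
    (f'_inj : injective f')
    (ff'_neq : forall i j : 'I_n, f i <> f' j) :
  let Hhat := smash ([set v (even_ix i) | i : 'I_n]
                     :|: [set v' (even_ix i) | i : 'I_n]) in
  let PM := [set M | perfect_matching (hedges G) (Hhat :\: terminals v f) M] in
  let PM' := [set M | perfect_matching (hedges G) (Hhat :\: terminals v' f') M] in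
  weight_preserving_bijection w wd PM PM' /\
  (forall P : 'I_n.*2.+1 -> seq (hvert G),
     (forall i : 'I_n.+1,
        is_primal_path (P (odd_ix i)) (v (odd_ix i)) (v' (odd_ix i))) ->
     (forall i : 'I_n, is_dual_path (P (even_ix i)) (f i) (f' i)) ->
     (forall i j : 'I_n.*2.+1, i != j -> [disjoint P i & P j]) ->
     forall I : {set 'I_n.*2.+1},
       weight_preserving_bijection w wd
         [set M in PM | [forall i in I, contains_path_matching (del_start (P i)) M]]
         [set M in PM' | [forall i in I, contains_path_matching (del_end (P i)) M]]).
Proof.
move=> Hhat PM PM'.
have v_out k : exists2 d, src d = v k & face d = None.
  by apply: outer_boundary_dart vv'_order _; rewrite mem_cat codom_f.
have v'_out k : exists2 d, src d = v' k & face d = None.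
  by apply: outer_boundary_dart vv'_order _; rewrite mem_cat mem_rev codom_f orbT.
have sd := outer_path_side v_path v_out v_deg2 v_face f_inj.
have sd' := outer_path_side v'_path v'_out v'_deg2 v'_face f'_inj.
(* A vertex of degree 2 on a bounded face is visited only once, so it cannot occur on both paths. *)
have ne i k : v (even_ix i) != v' k.
  have := outer_boundary_once vv'_order (v_deg2 i) (v_face i) (codom_f _ _).
  by rewrite mem_rev; apply: contra => /eqP->; exact: codom_f.
have ne' i k : v' (even_ix i) != v k.
  apply/eqP=> E; have := v'_deg2 i; have := v'_face i; rewrite E => vf vd.
  have := outer_boundary_once vv'_order vd vf (codom_f _ _).
  by rewrite mem_rev -E codom_f.
have EvEv' : [disjoint even_set v & even_set v'].
  apply/pred0P=> x /=; apply/negP=> /andP[/imsetP[i _ ->] /imsetP[k _ /eqP]].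
  by rewrite (negPf (ne _ _)).
have OEv' : [disjoint odd_set v & even_set v'].
  apply/pred0P=> x /=; apply/negP=> /andP[/imsetP[i _ ->] /imsetP[k _ /esym/eqP]].
  by rewrite (negPf (ne' _ _)).
have O'Ev : [disjoint odd_set v' & even_set v].
  apply/pred0P=> x /=; apply/negP=> /andP[/imsetP[i _ ->] /imsetP[k _ /esym/eqP]].
  by rewrite (negPf (ne _ _)).
(* A common edge would have a single bounded side, equal to some [f i] and to some [f' k]. *)
have incEv : [disjoint incident (even_set v) & incident (even_set v')].
  apply/pred0P=> e /=; apply/negP=> /andP[]; rewrite !inE.
  case/existsP=> b /imsetP[i _ eb] /existsP[b' /imsetP[k _ eb']].
  have bb' : b' = b \/ b' = ~~ b by case: b b' {eb eb'} => -[]; auto.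
  have [[b1 b2]|[b1 b2]] := even_dart v_out v_deg2 v_face eb;
    have [[c1 c2]|[c1 c2]] := even_dart v'_out v'_deg2 v'_face eb';
    case: bb' c1 c2 => ->; rewrite /opp /= ?negbK in b2 *; rewrite ?b1 ?b2 => // c1 c2;
    by [case: c1 => /ff'_neq|case: c2 => /ff'_neq].
have [e0 _] : exists e : edge G, true.
  by have [[e b] _ _] := v_out ord0; exists e.
set S := even_set v :|: even_set v'.
pose Vs := smash S :\: terminals v f; pose Vs' := smash S :\: terminals v' f'.
have CE : incident S = incident (even_set v) :|: incident (even_set v') by exact: incidentU.
have CE' : incident S = incident (even_set v') :|: incident (even_set v).
  by rewrite CE setUC.
have VsE e : (EV e \in Vs) = (e \notin incident S) by exact: EV_remaining.
have VsE' e : (EV e \in Vs') = (e \notin incident S) by exact: EV_remaining.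
have VsO x : (OV x \in Vs) = (x \notin odd_set v :|: even_set v :|: even_set v').
  by rewrite OV_remaining setUA.
have VsO' x : (OV x \in Vs') = (x \notin odd_set v' :|: even_set v' :|: even_set v).
  by rewrite OV_remaining -setUA [even_set v' :|: _]setUC.
have VsF g : (FV g \in Vs) = (Some g \notin side_faces f) by exact: FV_remaining.
have VsF' g : (FV g \in Vs') = (Some g \notin side_faces f') by exact: FV_remaining.
have Ev'Ev : [disjoint even_set v' & even_set v] by rewrite disjoint_sym.
have incEv' : [disjoint incident (even_set v') & incident (even_set v)].
  by rewrite disjoint_sym.
have inj := kind_inj sd sd' EvEv' OEv' O'Ev incEv e0 CE VsE VsO VsF.
have inj' := kind_inj sd' sd Ev'Ev O'Ev OEv' incEv' e0 CE' VsE' VsO' VsF'.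
have tr := kind_transfer sd sd' EvEv' OEv' O'Ev incEv e0 CE VsE VsO VsF VsE' VsO' VsF'.
have tr' := kind_transfer sd' sd Ev'Ev O'Ev OEv' incEv' e0 CE' VsE' VsO' VsF' VsE VsO VsF.
have wE M M' : M \in PM -> M' \in PM' -> kind M' = kind M ->
    mweight w wd M' = mweight w wd M.
  by rewrite !inE => pM pM' kE; rewrite (mweight_kind VsE' w wd pM') (mweight_kind VsE w wd pM) kE.
(* Covers both claims: the conditions imposed on the matchings depend only on [kind], and the first
   claim takes the condition [true]. *)
have main (Q Q' : pred {set hpair G}) :
    (forall M M', M \in PM -> M' \in PM' -> kind M' = kind M -> Q M = Q' M') ->
    weight_preserving_bijection w wd [set M in PM | Q M] [set M in PM' | Q' M].
  move=> QQ'; apply: bijection_of_kind.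
  - by move=> M M'; rewrite !inE => /andP[pM _] /andP[pM' _]; exact: inj.
  - by move=> M M'; rewrite !inE => /andP[pM _] /andP[pM' _]; exact: inj'.
  - move=> M; rewrite !inE => /andP[pM qM]; have [M' pM' kE] := tr M pM.
    by exists M'; rewrite // !inE pM' -(QQ' M) ?inE.
  - move=> M; rewrite !inE => /andP[pM qM]; have [M' pM' kE] := tr' M pM.
    by exists M'; rewrite // !inE pM' (QQ' _ M) ?inE.
  - by move=> M M'; rewrite !inE => /andP[pM _] /andP[pM' _]; apply: wE; rewrite inE.
split.
  suff: weight_preserving_bijection w wd [set M in PM | true] [set M in PM' | true].
    by congr weight_preserving_bijection; apply/setP=> M; rewrite !inE andbT.
  exact: main.
move=> P Podd Peven _ I; apply: main => M M'; rewrite !inE => pM pM' kE.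
apply: eq_forallb => k; congr (_ ==> _).
have [[i ->]|[i ->]] := odd_even_ix k.
  apply: (primal_path_transfer pM pM' kE (Podd i)).
    by rewrite VsO negbK !in_setU imset_f.
  by rewrite VsO' negbK !in_setU imset_f.
apply: (dual_path_transfer pM pM' VsE VsE' kE (Peven i)).
  by rewrite VsF negbK in_setU1 imset_f.
by rewrite VsF' negbK in_setU1 imset_f.
Qed.
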